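(* Let $\beta>0$ and let $a^*>0$ be the number characterized by $$a^*\int_0^\infty e^{-s}\sqrt{2\beta s}\,\tanh\!\left(a^*\sqrt{2\beta s}\right)ds=1.$$ For $a\ge 0$ let $\tau_a\in\mathcal{T}(\mathbb{R}_+)$ be $\tau_a(x):=\mathbf{1}_{[0,a)}(x)$, $x\in\mathbb{R}_+$. Then $\tau_a\in\mathcal{E}(\mathbb{R}_+)$ if and only if $a\in[0,a^*]$. Moreover, $$\mathcal{E}(\mathbb{R}_+)=\{\tau\in\mathcal{T}(\mathbb{R}_+):\overline{\ker(\tau)}=[a,\infty)\ \text{for some}\ a\in[0,a^*]\}.$$
   Context: Let $W$ be a standard one-dimensional Brownian motion on the canonical space (with its augmented filtration), and for $x\in\mathbb{R}_+=[0,\infty)$ let $X^x_s:=|x+W_s|$, $s\ge 0$ (one-dimensional Bessel process, i.e. reflected Brownian motion, started at $x$); $\mathbb{E}^x$ denotes expectation with $X=X^x$. The payoff is $g(x)=x$ and the discount function is $\delta(s)=\frac{1}{1+\beta s}$, $s\ge 0$. For a stopping time $\tau$, $J(x;\tau):=\mathbb{E}^x\left[\frac{X_\tau}{1+\beta\tau}\right]$, where on $\{\tau=\infty\}$ the integrand is $\limsup_{s\to\infty}\frac{X_s}{1+\beta s}$ (which is $0$ a.s.). A stopping policy is a Borel function $\tau:\mathbb{R}_+\to\{0,1\}$; $\mathcal{T}(\mathbb{R}_+)$ is the set of all stopping policies. $\ker(\tau):=\{x\in\mathbb{R}_+:\tau(x)=0\}$, with closure $\overline{\ker(\tau)}$,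 and $\mathcal{L}^*\tau(x):=\inf\{t>0:\tau(X^x_t)=0\}$ ($\inf\emptyset=\infty$). Define $\Theta\tau(x):=0$ if $x>J(x;\mathcal{L}^*\tau(x))$, $\Theta\tau(x):=1$ if $x<J(x;\mathcal{L}^*\tau(x))$, and $\Theta\tau(x):=\tau(x)$ if $x=J(x;\mathcal{L}^*\tau(x))$. $\tau\in\mathcal{T}(\mathbb{R}_+)$ is an equilibrium stopping policy if $\Theta\tau(x)=\tau(x)$ for all $x\in\mathbb{R}_+$; $\mathcal{E}(\mathbb{R}_+)$ is the set of all equilibrium stopping policies. *)

(* Defs.v *)
From HB Require Import structures.
From mathcomp Require Import all_boot all_order all_algebra.
From mathcomp Require Import all_classical all_reals all_analysis.

Set Implicit Arguments.
Unset Strict Implicit.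
Unset Printing Implicit Defensive.

Import Order.TTheory GRing.Theory Num.Theory.
Import numFieldNormedType.Exports.

Local Open Scope classical_set_scope.
Local Open Scope ring_scope.

Definition tanh (R : realType) (x : R) : R :=
  (expR x - expR (- x)) / (expR x + expR (- x)).

Definition mutually_independent d (T : measurableType d) (R : realType)
    (P : probability T R) (I : finType) (Y : I -> T -> R) : Prop :=
  forall (J : {set I}) (A : I -> set R), (forall i, measurable (A i)) ->
    P (\bigcap_(i in [set i | i \in J]) (Y i @^-1` A i)) =
    (\prod_(i in J) P (Y i @^-1` A i))%E.

(* Time is indexed by the whole line, but W t is constrained, and used, only
   for 0 <= t.  The second argument of normal_prob is the standard deviation.
   As on the canonical space, every path is continuous and starts at 0. *)
Record brownian_motion d (T : measurableType d) (R : realType)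
    (P : probability T R) (W : R -> {RV P >-> R}) : Prop := BrownianMotion {
  bm_start : forall w, W 0 w = 0 ;
  bm_continuous : forall w,
    {within `[0, +oo[, continuous (fun t : R => W t w)} ;
  bm_gaussian : forall s t : R, 0 <= s -> s < t ->
    forall A : set R, measurable A ->
      P ((fun w => W t w - W s w) @^-1` A) = normal_prob 0 (Num.sqrt (t - s)) A ;
  bm_independent : forall (n : nat) (t : nat -> R), 0 <= t 0 ->
    (forall k, (k < n)%N -> t k <= t k.+1) ->
    mutually_independent P (fun (k : 'I_n) w => W (t k.+1) w - W (t k) w)
}.

(* A policy on [0, +oo[ is represented by a function on R whose values at
   negative reals are never used; false stands for 0 (stop) and true for 1
   (continue). *)
Definition stopping_policy (R : realType) (tau : R -> bool) : Prop :=
  measurable_fun (`[0, +oo[%classic : set R) tau.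

Definition policy_ker (R : realType) (tau : R -> bool) : set R :=
  [set x | 0 <= x /\ tau x = false].

Definition cutoff (R : realType) (a : R) : R -> bool := fun x => 0 <= x < a.

Section Equilibrium.
Context d (T : measurableType d) (R : realType) (P : probability T R).
Variables (W : R -> {RV P >-> R}) (beta : R).

Definition reflected (x s : R) (w : T) : R := `|x + W s w|.

Definition discounted_payoff (x s : R) (w : T) : R :=
  reflected x s w / (1 + beta * s).

(* The value at -oo is irrelevant: random times are nonnegative. *)
Definition payoff_at (x : R) (t : \bar R) (w : T) : \bar R :=
  match t with
  | r%:E => (discounted_payoff x r w)%:E
  | +oo => limf_esup (fun s => (discounted_payoff x s w)%:E) (pinfty_nbhs R)
  | -oo => 0
  end%E.

Definition J (x : R) (sigma : T -> \bar R) : \bar R :=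
  (\int[P]_w payoff_at x (sigma w) w)%E.

Definition hitting_time (tau : R -> bool) (x : R) (w : T) : \bar R :=
  ereal_inf [set t%:E | t in [set t : R | 0 < t /\
                                tau (reflected x t w) = false]].

Definition Theta (tau : R -> bool) (x : R) : bool :=
  if (J x (hitting_time tau x) < x%:E)%E then false
  else if (x%:E < J x (hitting_time tau x))%E then true
  else tau x.

Definition equilibria : set (R -> bool) :=
  [set tau | stopping_policy tau /\ forall x, 0 <= x -> Theta tau x = tau x].

End Equilibrium.

(* Main.v *)
Require Import Defs.
From HB Require Import structures.
From mathcomp Require Import all_boot all_order all_algebra.
From mathcomp Require Import all_classical all_reals all_analysis.
From mathcomp Require Import measurable_realfun.
From mathcomp Require Import ring lra.

(** Let [X = |x + W|], let [L] be the hitting time of the kernel of a policy by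
    [X], and let [T(y, r)] be the first time at which [|y + W| >= r].

    *** Laplace transform of the exit time.
    The process [exp (th W_s - th^2 s / 2)] is a martingale, bounded up to
    [T(y, r)], so its value at [T(y, r)] has mean 1
    ([expectation_exit_exp_mart]).  Adding the identities for [th] and [- th]
    gives [E exp (- th^2 T / 2) = cosh (th y) / cosh (th r)]
    ([exit_laplace]); for [y = 0] it also gives that the exit side is
    symmetric whatever the exponential weight on [T]
    ([exit_laplace_place]).  The hyperbolic factor [1 / (1 + beta t)] is the
    mixture of the [exp (- s) exp (- beta s t)], hence
    [E (1 / (1 + beta T(y, r)))] is the integral [Phi y r] of
    [exp (- s) cosh (y q) / cosh (r q)], [q = sqrt (2 beta s)]
    ([exit_discount]).

    *** Kernels dense above a cutoff.
    Suppose that the closure of the kernel is [[a, oo)].  A path started at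
    [x <= a] meets the kernel between [T(x, a)] and [T(x, b)] for every
    [b > a], because it cannot go from [a] to [b] without crossing the kernel.
    As [Phi x] is continuous, no finer property of Brownian paths is needed:
    the value of waiting is [a * Phi x a] ([value_below_cutoff_ub],
    [value_below_cutoff_lb]).  The same squeeze shows that a path started above
    [a] hits at once, so that its value is [x] ([value_inside]).  The function
    [x |-> a * Phi x a - x] is convex, vanishes at [a], and its slope there is
    [a * I(a) - 1], where [I(a)] integrates [exp (- s) q tanh (a q)].  As
    [astar * I(astar) = 1], waiting is at least as good as stopping on [[0, a]]
    when [a <= astar] ([place_le_waiting]), and strictly worse just below [a]
    when [a > astar] ([waiting_lt_place]).

    *** No other equilibria.
    In an equilibrium, a state where waiting is strictly worse than stopping
    lies in the kernel.  A bounded kernel is impossible, since far above it the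
    value of waiting stays bounded ([value_above_bounded_ker]).  So is a gap
    [(b, c)] in the closure of the kernel: started in its middle [m], the path
    hits the kernel when it leaves the gap, at a place of mean [m] that does
    not correlate with the discount factor, so that waiting is worth
    [m * Phi 0 r < m] ([value_gap_lt]).  Hence the closure is a half-line.

    The hitting time of an arbitrary Borel kernel is never shown to be
    measurable.  Payoffs are nonnegative, so their integral is a lower integral
    and is monotone for all functions; every value is squeezed between
    integrals of functionals of the exit times, which are measurable. *)

Set Implicit Arguments.
Unset Strict Implicit.
Unset Printing Implicit Defensive.

Import Order.TTheory GRing.Theory Num.Theory.
Import numFieldNormedType.Exports.

Local Open Scope classical_set_scope.
Local Open Scope ring_scope.

(** * Lower integrals, independence and Gaussian integrals *)

Section LowerIntegral.
Context d (T : measurableType d) (R : realType) (mu : {measure set T -> \bar R}).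
Local Open Scope ereal_scope.

(** The integral of a nonnegative function is the supremum over the simple
    functions below it, hence monotone without measurability. *)
Lemma le_ge0_integral (f g : T -> \bar R) : (forall x, 0 <= f x) ->
  (forall x, f x <= g x) -> \int[mu]_x f x <= \int[mu]_x g x.
Proof.
move=> f0 fg; have g0 x : 0 <= g x by exact: le_trans (fg x).
rewrite !ge0_integralTE//; apply: le_ereal_sup => _ [h hf <-]; exists h => // x.
exact: le_trans (hf x) (fg x).
Qed.

Lemma ae_ub_integral (f g : T -> \bar R) : (forall x, 0 <= f x) ->
  (forall x, 0 <= g x) -> measurable_fun setT g ->
  {ae mu, forall x, f x <= g x} -> \int[mu]_x f x <= \int[mu]_x g x.
Proof.
move=> f0 g0 mg [N [mN N0 fgN]].
pose g' := fun x => if x \in N then +oo else g x.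
have mg' : measurable_fun setT g'.
  apply: measurable_fun_if => //; last exact: measurable_funTS.
  apply: (measurable_fun_bool true); rewrite setTI (_ : _ @^-1` _ = N)//.
  by apply/seteqP; split => x /=; [move=> /set_mem|move=> /mem_set].
apply: (@le_trans _ _ (\int[mu]_x g' x)).
  apply: le_ge0_integral => // x; rewrite /g'; case: ifPn => [_|]; first exact: leey.
  by rewrite notin_setE => xN; apply: contrapT => H; apply/xN/fgN.
rewrite (@ge0_ae_eq_integral _ _ _ mu setT g' g)//.
  by move=> x _; rewrite /g'; case: ifP.
exists N; split => // x /= H; apply: contrapT => xN; apply: H => _.
by rewrite /g' ifF//; apply/negbTE; rewrite notin_setE.
Qed.

End LowerIntegral.

Section IndependentProduct.
Context d (T : measurableType d) (R : realType).
Variables (mu : {finite_measure set T -> \bar R}) (P : probability T R).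
Variables X Y : {mfun T >-> R}.
Local Open Scope ereal_scope.

Let law : set R -> \bar R := pushforward mu X.

Let law0 : law set0 = 0. Proof. exact: measure0. Qed.

Let law_ge0 A : 0 <= law A. Proof. exact: measure_ge0. Qed.

Let law_sigma_additive : semi_sigma_additive law.
Proof. exact: measure_semi_sigma_additive. Qed.

HB.instance Definition _ :=
  isMeasure.Build _ _ _ law law0 law_ge0 law_sigma_additive.

Let law_fin : fin_num_fun law.
Proof.
move=> A mA; apply: fin_num_measure.
by rewrite -[X in measurable X]setTI; exact: measurable_funP.
Qed.

HB.instance Definition _ := Measure_isFinite.Build _ _ _ law law_fin.

(** The joint law is the product of the marginals, so Tonelli applies.  The
    measure [mu] is a restriction of [P] in the application. *)
Lemma integral_prod_indep (f g : R -> \bar R) :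
  measurable_fun setT f -> measurable_fun setT g ->
  (forall x, 0 <= f x) -> (forall x, 0 <= g x) ->
  (forall A B, measurable A -> measurable B ->
     mu (X @^-1` A `&` Y @^-1` B) = mu (X @^-1` A) * P (Y @^-1` B)) ->
  \int[mu]_w (f (X w) * g (Y w)) = \int[mu]_w f (X w) * \int[P]_w g (Y w).
Proof.
move=> mf mg f0 g0 XY.
pose Z w := (X w, Y w).
have mZ : measurable_fun setT Z by exact: measurable_fun_pair.
pose F (z : R * R) := f z.1 * g z.2.
have mF : measurable_fun setT F.
  by apply: emeasurable_funM; exact: measurableT_comp.
have F0 z : 0 <= F z by exact: mule_ge0.
have joint (A : set (R * R)) : measurable A ->
    pushforward mu Z A = (law \x distribution P Y) A.
  by move=> mA; apply/esym; apply: product_measure_unique => // B C; exact: XY.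
transitivity (\int[pushforward mu Z]_z F z).
  by rewrite ge0_integral_pushforward.
rewrite (eq_measure_integral (law \x distribution P Y)); last first.
  by move=> A mA _; exact: joint.
rewrite fubini_tonelli1// /fubini_F.
under eq_integral => x _.
  rewrite /F /= ge0_integralZl//.
  over.
rewrite ge0_integralZr//; last exact: integral_ge0.
by rewrite !ge0_integral_pushforward.
Qed.

End IndependentProduct.

Section GaussianTransform.
Context (R : realType).

(** The density is the Radon-Nikodym derivative up to a null set. *)
Lemma ge0_integral_normal_prob (m s : R) (f : R -> \bar R) :
  measurable_fun setT f -> (forall x, 0 <= f x)%E ->
  (\int[normal_prob m s]_x f x =
   \int[lebesgue_measure]_x (f x * (normal_pdf m s x)%:E))%E.
Proof.
move=> mf f0.
have dom := @normal_prob_dominates R m s.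
have mpdf : measurable_fun setT (fun x : R => (normal_pdf m s x)%:E).
  by apply/measurable_EFinP; exact: measurable_normal_pdf.
have iRN := Radon_Nikodym_SigmaFinite.f_integrable dom.
rewrite -(Radon_Nikodym_SigmaFinite.change_of_variables dom)//.
apply: ge0_ae_eq_integral => //.
- by apply: emeasurable_funM => //; exact: (measurable_int lebesgue_measure).
- exact: emeasurable_funM.
- by move=> x _; rewrite mule_ge0// (Radon_Nikodym_SigmaFinite.f_ge0 dom).
- by move=> x _; rewrite mule_ge0// lee_fin normal_pdf_ge0.
apply: ae_eqe_mul2l; apply: integral_ae_eq => // E _ mE.
by rewrite -Radon_Nikodym_SigmaFinite.f_integral.
Qed.

(** Completing the square: the Gaussian density tilted by an exponential is a
    translate of itself, up to the factor [exp (th^2 s^2 / 2)]. *)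
Lemma normal_exp_moment (s th : R) : 0 < s ->
  (\int[normal_prob 0 s]_z (expR (th * z))%:E =
   (expR (th ^+ 2 * s ^+ 2 / 2))%:E)%E.
Proof.
move=> s0.
have mE : measurable_fun setT (fun z : R => (expR (th * z))%:E).
  by apply/measurable_EFinP/measurableT_comp => //; exact: mulrl_measurable.
rewrite ge0_integral_normal_prob//.
transitivity (\int[lebesgue_measure]_z
    ((expR (th ^+ 2 * s ^+ 2 / 2))%:E * (normal_pdf (th * s ^+ 2) s z)%:E))%E.
  apply: eq_integral => z _; rewrite -!EFinM; congr EFin.
  rewrite !normal_pdfE ?gt_eqF// mulrCA [RHS]mulrCA; congr (_ * _).
  rewrite /normal_fun -!expRD; congr expR.
  by field; rewrite gt_eqF.
rewrite ge0_integralZl//.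
- by rewrite integral_normal_pdf mule1.
- by apply/measurable_EFinP; exact: measurable_normal_pdf.
- by move=> x _; rewrite lee_fin normal_pdf_ge0.
Qed.

End GaussianTransform.

Section IndependentFamily.
Context d (T : measurableType d) (R : realType) (P : probability T R).
Variables (n : nat) (Y : 'I_n.+1 -> {mfun T >-> R}).
Hypothesis Yindep : mutually_independent P (fun i => Y i : T -> R).

(** A pi-system that generates the sigma-algebra of all variables but the
    last. *)
Definition past_rectangles : set (set T) :=
  [set E | exists2 A : 'I_n.+1 -> set R, (forall i, measurable (A i)) /\
     A ord_max = setT & E = \bigcap_(i in setT) (Y i @^-1` A i)].

Lemma past_rectangles_measurable : past_rectangles `<=` measurable.
Proof.
move=> _ [A [mA _] ->]; apply: fin_bigcap_measurable => // i _.
by rewrite -[X in measurable X]setTI; exact: measurable_funP.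
Qed.

Lemma past_rectangles_setI : setI_closed past_rectangles.
Proof.
move=> _ _ [A [mA AT] ->] [B [mB BT] ->].
exists (fun i => A i `&` B i).
  by split => [i|]; [exact: measurableI|rewrite AT BT setTI].
by rewrite -bigcapI; apply: eq_bigcapr => i _; rewrite preimage_setI.
Qed.

Lemma past_measurable (i : 'I_n.+1) (B : set R) : measurable B ->
  i != ord_max -> <<s past_rectangles >> (Y i @^-1` B).
Proof.
move=> mB imax; apply: sub_gen_smallest.
exists (fun j => if j == i then B else setT).
  split=> [j|]; first by case: ifP.
  by rewrite ifF// eq_sym; exact/negbTE.
apply/seteqP; split => [w Bw j _|w /(_ i Logic.I)] /=; last by rewrite eqxx.
by case: eqP => [->|].
Qed.

(** Both sides are finite measures in [E] that agree on the pi-system of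
    rectangles. *)
Lemma past_indep (E : set T) (B : set R) : <<s past_rectangles >> E ->
  measurable B ->
  (P (E `&` Y ord_max @^-1` B) = P E * P (Y ord_max @^-1` B))%E.
Proof.
move=> sE mB.
have mYB : measurable (Y ord_max @^-1` B).
  by rewrite -[X in measurable X]setTI; exact: measurable_funP.
have c0 : 0 <= fine (P (Y ord_max @^-1` B)) by rewrite fine_ge0.
(* The right-hand side is a multiple of [P] as a measure in [E]. *)
transitivity (mscale (NngNum c0) P E); last first.
  by rewrite /mscale/= muleC fineK// fin_num_measure.
apply: (@g_sigma_algebra_measure_unique _ R T past_rectangles
  past_rectangles_measurable (fun=> setT) _ _ (mrestr P mYB)
  (mscale (NngNum c0) P) past_rectangles_setI _ _ E sE).
- move=> _; exists (fun=> setT) => //.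
  by apply/seteqP; split.
- exact: bigcup_const.
- move=> _ [A [mA AT] ->];
  change (P ((\bigcap_(i in setT) (Y i @^-1` A i)) `&` (Y ord_max @^-1` B)) =
    (fine (P (Y ord_max @^-1` B)))%:E * P (\bigcap_(i in setT) (Y i @^-1` A i)))%E.
  rewrite fineK ?fin_num_measure//.
  (* The joint event is again a rectangle, with [B] in the last coordinate. *)
  pose A' := fun i => if i == ord_max then B else A i.
  have mA' i : measurable (A' i) by rewrite /A'; case: ifP.
  have allE : [set i | i \in [set: 'I_n.+1]%SET] = setT.
    by apply/seteqP; split => // i _ /=; rewrite finset.in_setT.
  have := Yindep [set: 'I_n.+1]%SET mA.
  rewrite allE (bigD1 ord_max) ?finset.in_setT//= AT preimage_setT.
  rewrite probability_setT mul1e => ->.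
  have := Yindep [set: 'I_n.+1]%SET mA'.
  rewrite allE (bigD1 ord_max) ?finset.in_setT//= {2}/A' eqxx.
  under [in RHS]eq_bigr => i /andP[_ /negbTE imax] do rewrite /A' imax.
  move=> <-; congr (P _); apply/seteqP; split => w /=.
    by move=> [Aw Bw] i _; rewrite /A'; case: eqP => [->//|_]; exact: Aw.
  move=> Aw; split => [i _|]; last by have := Aw ord_max; rewrite /A' eqxx; apply.
  have := Aw i; rewrite /A'; case: eqP => [->|_]; last exact.
  by rewrite AT.
- move=> _; change (P (setT `&` (Y ord_max @^-1` B)) < +oo)%E.
  by rewrite setTI -ge0_fin_numE// fin_num_measure.
Qed.

End IndependentFamily.

(** * Independence of an increment from the past of the path *)

Section PathContinuity.
Context (R : realType).
Implicit Types f : R -> R.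

Lemma within_continuous_abs f : {within `[0, +oo[, continuous f} ->
  continuous (fun t : R => f `|t|).
Proof.
move=> /subspace_continuousP fc s.
have s0 : `[0, +oo[%classic `|s| by rewrite /= in_itv/= normr_ge0.
apply: cvg_trans (fc _ s0) => A [/= e e0 eA].
rewrite nbhs_simpl/=; exists e => //= t ste.
apply: eA; last by rewrite /= in_itv/= normr_ge0.
by rewrite /ball/= (le_lt_trans _ ste)//; exact: ler_dist_dist.
Qed.

Lemma continuous_le_dyadic (f : R -> R) (c t : R) : continuous f -> 0 <= t ->
  (forall m k, (k <= 2 ^ m)%N -> f (t * (k%:R / 2 ^+ m)) <= c) ->
  forall s, 0 <= s <= t -> f s <= c.
Proof.
move=> fc t0 fle s /andP[s0 st]; rewrite leNgt; apply/negP => cfs.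
have : nbhs (f s) [set x | c < x] by exact: lt_nbhsr.
move=> /(fc s)[e /= e0 es].
have [t00|t0'] := eqVneq t 0.
  have s00 : s = 0 by apply/eqP; rewrite eq_le s0 andbT -t00.
  by have := fle 0%N 0%N isT; rewrite mul0r mulr0 -s00 leNgt cfs.
have {t0'}t0 : 0 < t by rewrite lt_neqAle eq_sym t0'.
have [m mte] : exists m, t / 2 ^+ m < e.
  exists (Num.truncn (t / e)).+1; rewrite ltr_pdivrMr ?exprn_gt0// -ltr_pdivrMl//.
  rewrite mulrC (lt_trans (truncnS_gt _))// -natrX ltr_nat.
  exact: ltn_expl.
pose k := Num.truncn (s / t * 2 ^+ m).
have stm0 : 0 <= s / t * 2 ^+ m by rewrite !mulr_ge0 ?invr_ge0 ?exprn_ge0 ?(ltW t0).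
have /andP[k1 k2] := truncn_itv stm0.
have k2m : (k <= 2 ^ m)%N.
  rewrite -(ler_nat R) (le_trans k1)// natrX ler_piMl ?exprn_ge0//.
  by rewrite ler_pdivrMr// mul1r.
have := fle m k k2m; rewrite leNgt => /negP; apply; apply: es.
have m0 : 0 < 2 ^+ m :> R by rewrite exprn_gt0.
have -> : t * (k%:R / 2 ^+ m) = k%:R * (t / 2 ^+ m) by rewrite mulrCA.
have sE : s = s / t * 2 ^+ m * (t / 2 ^+ m).
  by field; rewrite (gt_eqF t0) expf_neq0 ?pnatr_eq0.
rewrite /ball/= (le_lt_trans _ mte)// {1}sE -mulrBl normrM.
rewrite [X in _ * X]ger0_norm ?divr_ge0 ?(ltW t0) ?(ltW m0)//.
rewrite ler_piMl ?divr_ge0 ?(ltW t0) ?(ltW m0)// ger0_norm ?subr_ge0//.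
by rewrite lerBlDr nat1r ltW.
Qed.

End PathContinuity.

Section Brownian.
Context d (T : measurableType d) (R : realType) (P : probability T R).
Variable W : R -> {RV P >-> R}.
Hypothesis BW : brownian_motion W.

Lemma path_continuous w : continuous (fun t : R => W `|t| w).
Proof. exact/(within_continuous_abs (f := fun t => W t w))/bm_continuous. Qed.

Definition indep_of (F E : set T) := (P (E `&` F) = P E * P F)%E.

(** Independence from a fixed event passes to monotone limits.  This reduces
    events about a whole path to events about finitely many dates. *)
Lemma indep_nonincreasing (F : set T) (E : (set T)^nat) : measurable F ->
  (forall i, measurable (E i)) -> nonincreasing_seq E ->
  (forall i, indep_of F (E i)) -> indep_of F (\bigcap_i E i).
Proof.
move=> mF mE dE iE.
have mcap : measurable (\bigcap_i E i) by exact: bigcap_measurable.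
have Pfin A : measurable A -> (P A < +oo)%E.
  by move=> mA; rewrite -ge0_fin_numE// fin_num_measure.
have h1 : (P \o E) n @[n --> \oo] --> P (\bigcap_i E i).
  by apply: nonincreasing_cvg_mu => //; exact: Pfin.
have h2 : (P \o (fun i => E i `&` F)) n @[n --> \oo] --> P (\bigcap_i E i `&` F).
  rewrite -bigcapIl; last by exists 0%N.
  apply: nonincreasing_cvg_mu => //.
  - by apply: Pfin; exact: measurableI.
  - by move=> i; exact: measurableI.
  - by apply: bigcap_measurable => // i _; exact: measurableI.
  - by move=> i j ij; apply/subsetPset; apply: setSI; apply/subsetPset; exact: dE.
have h3 : (P \o (fun i => E i `&` F)) n @[n --> \oo] --> (P (\bigcap_i E i) * P F)%E.
  rewrite (_ : _ \o _ = fun n => (P (E n) * P F)%E); last first.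
    by apply/funext => n; exact: iE.
  by apply: cvgeZr => //; exact: fin_num_measure.
exact: (cvg_unique _ h2 h3).
Qed.

Lemma indep_nondecreasing (F : set T) (E : (set T)^nat) : measurable F ->
  (forall i, measurable (E i)) -> nondecreasing_seq E ->
  (forall i, indep_of F (E i)) -> indep_of F (\bigcup_i E i).
Proof.
move=> mF mE dE iE.
have mcup : measurable (\bigcup_i E i) by exact: bigcup_measurable.
have h1 : (P \o E) n @[n --> \oo] --> P (\bigcup_i E i).
  by apply: nondecreasing_cvg_mu.
have h2 : (P \o (fun i => E i `&` F)) n @[n --> \oo] --> P (\bigcup_i E i `&` F).
  rewrite setI_bigcupl; apply: nondecreasing_cvg_mu => //.
  - by move=> i; exact: measurableI.
  - by apply: bigcup_measurable => // i _; exact: measurableI.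
  - by move=> i j ij; apply/subsetPset; apply: setSI; apply/subsetPset; exact: dE.
have h3 : (P \o (fun i => E i `&` F)) n @[n --> \oo] --> (P (\bigcup_i E i) * P F)%E.
  rewrite (_ : _ \o _ = fun n => (P (E n) * P F)%E); last first.
    by apply/funext => n; exact: iE.
  by apply: cvgeZr => //; exact: fin_num_measure.
exact: (cvg_unique _ h2 h3).
Qed.

Section Grid.
Variables (t dl : R) (N : nat).
Hypotheses (t0 : 0 <= t) (dl0 : 0 < dl) (N0 : (0 < N)%N).

Let grid (k : nat) : R := if (k <= N)%N then t * (k%:R / N%:R) else t + dl.

Let incr (i : 'I_N.+1) : {mfun T >-> R} := W (grid i.+1) - W (grid i).

Let grid0 : grid 0 = 0. Proof. by rewrite /grid/= mul0r mulr0. Qed.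

Let gridN : grid N = t.
Proof. by rewrite /grid leqnn divff ?mulr1// pnatr_eq0 -lt0n. Qed.

Let gridS : grid N.+1 = t + dl. Proof. by rewrite /grid ltnn. Qed.

Let incr_indep : mutually_independent P (fun i => incr i : T -> R).
Proof.
apply: (bm_independent BW); rewrite ?grid0// => k; rewrite ltnS leq_eqVlt.
move=> /predU1P[->|kN]; first by rewrite gridN gridS lerDl ltW.
rewrite /grid kN (ltnW kN) ler_wpM2l// ler_wpM2r ?invr_ge0// ler_nat.
by [].
Qed.

Let past : measurableType _ := g_sigma_algebraType (past_rectangles incr).

Let grid_measurable k : (k <= N)%N ->
  measurable_fun [set: past] (W (grid k) : past -> R).
Proof.
elim: k => [_|k IH kN].
  rewrite grid0 (_ : (W 0 : T -> R) = cst 0)//; apply/funext => w.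
  exact: bm_start BW w.
have -> : (W (grid k.+1) : T -> R) =
    (W (grid k) : past -> R) \+ (incr (Ordinal (ltnW kN : (k < N.+1)%N)) : past -> R).
  by apply/funext => w /=; rewrite addrC subrK.
apply: measurable_funD; first exact: (IH (ltnW kN)).
move=> _ B mB; rewrite setTI; apply: past_measurable => //.
by rewrite -val_eqE/= ltn_eqF//.
Qed.

(** Up to date [t] the path is observed at [N] equally spaced dates: its values
    there are sums of increments that are independent of the next increment. *)
Lemma grid_indep (y rho : R) (C B : set R) : measurable C -> measurable B ->
  indep_of ((fun w => W (t + dl) w - W t w) @^-1` B)
    ((\bigcap_(k in [set k | (k <= N)%N])
        [set w | `|y + W (t * (k%:R / N%:R)) w| <= rho]) `&` (W t @^-1` C)).
Proof.
move=> mC mB.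
have := past_indep incr_indep (B := B); rewrite /indep_of.
have -> : (incr ord_max : T -> R) = fun w => W (t + dl) w - W t w.
  by apply/funext => w; rewrite /incr/= gridN gridS.
apply=> //; apply: (@measurableI _ past).
  apply: (@bigcap_measurable _ past) => [|k kN]; first by exists 0%N.
  have mk : measurable_fun [set: past] (fun w : past => `|y + W (t * (k%:R / N%:R)) w|).
    apply: measurableT_comp => //; apply: measurable_funD => //.
    by have := grid_measurable kN; rewrite /grid kN.
  rewrite -[X in measurable X]setTI.
  have := mk measurableT `]-oo, rho]%classic (measurable_itv _).
  congr (_ _ (_ `&` _)); apply/seteqP; split => w /=; rewrite in_itv//=.
have mt : measurable_fun [set: past] (W t : past -> R).
  by have := grid_measurable (leqnn N); rewrite gridN.
by have := mt measurableT _ mC; rewrite setTI.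
Qed.

End Grid.

(** A closed constraint on a continuous path need only be checked at the
    dyadic dates. *)
Lemma bounded_path_dyadic (t y rho : R) : 0 <= t ->
  [set w | forall s, 0 <= s <= t -> `|y + W s w| <= rho] =
  \bigcap_m \bigcap_(k in [set k | (k <= 2 ^ m)%N])
     [set w | `|y + W (t * (k%:R / (2 ^ m)%:R)) w| <= rho].
Proof.
move=> t0; apply/seteqP; split=> [w Ew m _ k /= k2|w Ew s st].
  apply: Ew; rewrite mulr_ge0 ?divr_ge0//= ler_piMr// ler_pdivrMr.
    by rewrite mul1r ler_nat.
  by rewrite ltr0n expn_gt0.
have /andP[s0 _] := st.
have cf : continuous (fun s : R => `|y + W `|s| w|).
  move=> x; apply: cvg_norm; apply: cvgD; first exact: cvg_cst.
  exact: path_continuous.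
rewrite -[X in W X w](ger0_norm s0); apply: (continuous_le_dyadic cf t0 _ st).
move=> m k k2m; have := Ew m I k k2m; rewrite /= natrX => h.
rewrite [X in W X w]ger0_norm//; apply: mulr_ge0 => //.
Qed.

Lemma measurable_path_le (s y rho : R) : measurable [set w | `|y + W s w| <= rho].
Proof.
rewrite -[X in measurable X]setTI.
have : measurable_fun setT (fun w => `|y + W s w|).
  by apply: measurableT_comp => //; apply: measurable_funD.
move=> /(_ measurableT `]-oo, rho]%classic (measurable_itv _)).
by congr (_ _ (_ `&` _)); apply/seteqP; split => w /=; rewrite in_itv//=.
Qed.

Lemma measurable_bounded_path (t y rho : R) : 0 <= t ->
  measurable [set w | forall s, 0 <= s <= t -> `|y + W s w| <= rho].
Proof.
move=> t0; rewrite bounded_path_dyadic//; apply: bigcap_measurable => // m _.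
apply: bigcap_measurable => [|k _]; first by exists 0%N.
exact: measurable_path_le.
Qed.

Lemma bounded_path_indep (t dl y rho : R) (C B : set R) : 0 <= t -> 0 < dl ->
  measurable C -> measurable B ->
  indep_of ((fun w => W (t + dl) w - W t w) @^-1` B)
    ([set w | forall s, 0 <= s <= t -> `|y + W s w| <= rho] `&` (W t @^-1` C)).
Proof.
move=> t0 dl0 mC mB.
have mC' : measurable (W t @^-1` C).
  by rewrite -[X in measurable X]setTI; exact: measurable_funP.
rewrite bounded_path_dyadic// -bigcapIl; last by exists 0%N.
apply: indep_nonincreasing.
- by rewrite -[X in measurable X]setTI; apply: measurable_funB.
- move=> m; apply: measurableI => //; apply: bigcap_measurable => [|k _].
    by exists 0%N.
  exact: measurable_path_le.
- apply/nonincreasing_seqP => m; apply/subsetPset => w [Ew Cw]; split => // k /= k2m.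
  have := Ew (k * 2)%N; rewrite /= expnSr leq_mul2r k2m orbT => /(_ isT).
  by rewrite !natrM -mulf_div divff ?mulr1// pnatr_eq0.
- by move=> m; apply: grid_indep => //; rewrite expn_gt0.
Qed.

(** By compactness, a continuous path that stays below [r] on [[0, t]] stays
    below some [r - 1 / (j + 1)].  This writes the open constraint as a union
    of closed ones. *)
Lemma survival_bigcup (t y r : R) : 0 <= t ->
  [set w | forall s, 0 <= s <= t -> `|y + W s w| < r] =
  \bigcup_j [set w | forall s, 0 <= s <= t -> `|y + W s w| <= r - j.+1%:R^-1].
Proof.
move=> t0; apply/seteqP; split => w; last first.
  move=> [j _ Dw] s st; rewrite (le_lt_trans (Dw s st))// gtrBl.
  by rewrite invr_gt0.
move=> /= Ew.
have cf : {within `[0, t], continuous (fun s : R => `|y + W `|s| w|)}.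
  apply: continuous_subspaceT => x; apply: cvg_norm; apply: cvgD; first exact: cvg_cst.
  exact: path_continuous.
have [c c0t cmax] := EVT_max t0 cf.
have /andP[c0 ct] : 0 <= c <= t by move: c0t; rewrite in_itv.
have cr : 0 < r - `|y + W c w| by rewrite subr_gt0 Ew// c0 ct.
exists (Num.truncn (r - `|y + W c w|)^-1) => // s /andP[s0 st].
have := cmax s; rewrite in_itv/= s0 st => /(_ isT).
rewrite (ger0_norm s0) (ger0_norm c0) => /le_trans; apply.
rewrite lerBrDr -lerBrDl.
rewrite invf_ple ?posrE ?ltr0n//. by rewrite ltW ?truncnS_gt.
Qed.

Lemma measurable_survival (t y r : R) : 0 <= t ->
  measurable [set w | forall s, 0 <= s <= t -> `|y + W s w| < r].
Proof.
move=> t0; rewrite survival_bigcup//; apply: bigcup_measurable => j _.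
exact: measurable_bounded_path.
Qed.

(** The weak Markov property in the only form needed: survival up to [t] and
    the position at [t] are jointly independent of the next increment. *)
Lemma survival_indep (t dl y r : R) (C B : set R) : 0 <= t -> 0 < dl ->
  measurable C -> measurable B ->
  indep_of ((fun w => W (t + dl) w - W t w) @^-1` B)
    ([set w | forall s, 0 <= s <= t -> `|y + W s w| < r] `&` (W t @^-1` C)).
Proof.
move=> t0 dl0 mC mB.
pose D j := [set w | forall s, 0 <= s <= t -> `|y + W s w| <= r - j.+1%:R^-1].
have mD j : measurable (D j).
  exact: measurable_bounded_path.
have mC' : measurable (W t @^-1` C).
  by rewrite -[X in measurable X]setTI; exact: measurable_funP.
rewrite survival_bigcup// setI_bigcupl; apply: indep_nondecreasing.
- by rewrite -[X in measurable X]setTI; apply: measurable_funB.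
- by move=> j; apply: measurableI => //; exact: mD.
- apply/nondecreasing_seqP => j; apply/subsetPset; apply: setSI => w Dw s st.
  rewrite (le_trans (Dw s st))// lerD2l lerN2 lef_pV2 ?posrE ?ltr0n//.
  by rewrite ler_nat.
- by move=> j; exact: bounded_path_indep.
Qed.

End Brownian.

(** * The exponential martingale *)

Section RestrictedIntegral.
Context d (T : measurableType d) (R : realType) (mu : {measure set T -> \bar R}).

Lemma ge0_integral_mrestr (D : set T) (mD : measurable D) (f : T -> \bar R) :
  measurable_fun setT f -> (forall x, 0 <= f x)%E ->
  (\int[mrestr mu mD]_x f x = \int[mu]_(x in D) f x)%E.
Proof.
move=> mf f0.
rewrite -[in LHS](setUv D) ge0_integral_setU//=.
- rewrite [X in (_ + X)%E](eq_measure_integral mzero); last first.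
    move=> A mA AD; transitivity (mu (A `&` D)) => //.
    by rewrite (_ : A `&` D = set0) ?measure0//; apply/seteqP; split => // x [/AD].
  rewrite integral_measure_zero adde0.
  apply: eq_measure_integral => A mA AD.
  by transitivity (mu (A `&` D)) => //; rewrite setIidl.
- exact: measurableC.
- by rewrite setUv.
- exact/disj_setPCl.
Qed.

End RestrictedIntegral.

Section FirstTime.
Context (R : realType).
Implicit Types (S : set R) (C : set R) (f : R -> R).

Lemma ereal_inf_closure S l : ereal_inf (EFin @` S) = l%:E -> closure S l.
Proof.
move=> infS B [e /= e0 eB].
have : (ereal_inf (EFin @` S) < (l + e)%:E)%E by rewrite infS lte_fin ltrDl.
move=> /ereal_inf_lt[_ [s Ss <-]]; rewrite lte_fin => sle.
exists s; split=> //; apply: eB; rewrite /ball/= distrC ger0_norm ?ltrBlDl//.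
by rewrite subr_ge0 -lee_fin -infS; apply: ereal_inf_lbound; exists s.
Qed.

(** The infimum of a set of times is a limit of its points, so a closed
    constraint satisfied on the set is satisfied at the infimum. *)
Lemma closed_first_time C f S l : closed C -> continuous f ->
  (forall s, S s -> C (f s)) -> ereal_inf (EFin @` S) = l%:E -> C (f l).
Proof.
move=> cC cf SC /ereal_inf_closure Sl.
have : closed (f @^-1` C) by apply: closed_comp => // x _; exact: cf.
by apply; exact: closure_subset Sl.
Qed.

End FirstTime.

Section ExponentialMartingale.
Context d (T : measurableType d) (R : realType) (P : probability T R).
Variable W : R -> {RV P >-> R}.
Hypothesis BW : brownian_motion W.

Definition exp_mart (th s : R) (w : T) : R := expR (th * W s w - th ^+ 2 / 2 * s).

Lemma measurable_exp_mart th s : measurable_fun setT (exp_mart th s).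
Proof.
apply: measurableT_comp => //; apply: measurable_funB => //.
exact: measurable_funM.
Qed.

Lemma exp_mart0 th w : exp_mart th 0 w = 1.
Proof. by rewrite /exp_mart (bm_start BW) !mulr0 subr0 expR0. Qed.

Lemma increment_exp_moment (th t dl : R) : 0 <= t -> 0 < dl ->
  (\int[P]_w (expR (th * (W (t + dl) w - W t w)))%:E = (expR (th ^+ 2 * dl / 2))%:E)%E.
Proof.
move=> t0 dl0.
pose Y : {mfun T >-> R} := W (t + dl) - W t.
have mE : measurable_fun setT (fun z : R => (expR (th * z))%:E).
  by apply/measurable_EFinP/measurableT_comp => //; exact: mulrl_measurable.
transitivity (\int[distribution P Y]_z (expR (th * z))%:E)%E.
  by rewrite ge0_integral_distribution//.
(* The Gaussian law lives on the copy of [R] that carries the Lebesgue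
   sigma-algebra; both copies have the same measurable sets. *)
have mid : measurable_fun [set: measurableTypeR R] (id : measurableTypeR R -> R).
  by move=> _ A mA; rewrite setTI.
pose idm : {mfun measurableTypeR R >-> R} :=
  HB.pack (id : measurableTypeR R -> R) (isMeasurableFun.Build _ _ _ _ _ mid).
transitivity (\int[distribution (normal_prob 0 (Num.sqrt dl)) idm]_z (expR (th * z))%:E)%E.
  apply: eq_measure_integral => A mA _; have tdl : t < t + dl by rewrite ltrDl.
  by have := bm_gaussian BW t0 tdl mA; rewrite addrAC subrr add0r.
rewrite ge0_integral_distribution//.
by rewrite [LHS]normal_exp_moment ?sqrtr_gt0// sqr_sqrtr// ltW.
Qed.

(** The martingale property on the event that the path has survived up to [t].
    The increment is independent of that event and of [W t], and its
    exponential moment is the compensator. *)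
Lemma exp_mart_step (th y r t dl : R) : 0 <= t -> 0 < dl ->
  let A := [set w | forall s, 0 <= s <= t -> `|y + W s w| < r] in
  (\int[P]_(w in A) (exp_mart th (t + dl) w)%:E =
   \int[P]_(w in A) (exp_mart th t w)%:E)%E.
Proof.
move=> t0 dl0 A; have mA : measurable A by exact: measurable_survival.
pose Y : {mfun T >-> R} := W (t + dl) - W t.
pose f (x : R) := (expR (th * x - th ^+ 2 / 2 * (t + dl)))%:E.
pose g (z : R) := (expR (th * z))%:E.
have mg : measurable_fun setT g.
  by apply/measurable_EFinP/measurableT_comp => //; exact: mulrl_measurable.
have mf : measurable_fun setT f.
  apply/measurable_EFinP/measurableT_comp => //; apply: measurable_funB => //.
have mM s : measurable_fun setT (EFin \o exp_mart th s).
  by apply/measurable_EFinP; exact: measurable_exp_mart.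
have M0 s w : (0 <= (EFin \o exp_mart th s) w)%E by rewrite lee_fin expR_ge0.
rewrite -(ge0_integral_mrestr P mA (mM (t + dl)) (M0 _)).
rewrite -(ge0_integral_mrestr P mA (mM t) (M0 _)).
transitivity (\int[mrestr P mA]_w (f (W t w) * g (Y w)))%E.
  apply: eq_integral => w _; rewrite /f /g -EFinM -expRD /exp_mart.
  have -> : Y w = W (t + dl) w - W t w by [].
  by congr (expR _)%:E; field.
have f0 x : (0 <= f x)%E by rewrite lee_fin expR_ge0.
have g0 x : (0 <= g x)%E by rewrite lee_fin expR_ge0.
rewrite (@integral_prod_indep _ _ _ (mrestr P mA) P (W t) Y f g mf mg f0 g0).
  2:{ move=> C B mC mB.
  have := survival_indep BW y r t0 dl0 mC mB; rewrite /indep_of => indep.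
  change (P ((W t @^-1` C `&` Y @^-1` B) `&` A) =
    P (W t @^-1` C `&` A) * P (Y @^-1` B))%E.
  by rewrite [in RHS]setIC -indep setIC setIA. }
have -> : (\int[P]_w g (Y w) = (expR (th ^+ 2 * dl / 2))%:E)%E.
  exact: increment_exp_moment.
rewrite -ge0_integralZr//; last exact: measurableT_comp.
apply: eq_integral => w _; rewrite /f -EFinM -expRD /= /exp_mart.
by congr (expR _)%:E; field.
Qed.

End ExponentialMartingale.

(** * Exit times and their approximation from above *)

Section ExitTime.
Context d (T : measurableType d) (R : realType) (P : probability T R).
Variable W : R -> {RV P >-> R}.
Hypothesis BW : brownian_motion W.

Definition exit_time (y r : R) (w : T) : \bar R :=
  ereal_inf (EFin @` [set s | 0 <= s /\ r <= `|y + W s w|]).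

Lemma exit_time_ge0 y r w : (0 <= exit_time y r w)%E.
Proof. by apply: le_ereal_inf_tmp => _ [s [s0 _] <-]; rewrite lee_fin. Qed.

Lemma exit_time_le y r s w : 0 <= s -> r <= `|y + W s w| ->
  (exit_time y r w <= s%:E)%E.
Proof. by move=> s0 rs; apply: ereal_inf_lbound; exists s. Qed.

Lemma before_exit_time y r s w : 0 <= s -> (s%:E < exit_time y r w)%E ->
  `|y + W s w| < r.
Proof.
move=> s0; apply: contraTT; rewrite -!leNgt; exact: exit_time_le.
Qed.

Lemma dist_path_continuous y w : continuous (fun s : R => `|y + W `|s| w|).
Proof.
move=> x; apply: cvg_norm; apply: cvgD; first exact: cvg_cst.
exact: path_continuous.
Qed.

Lemma exit_time_attained y r w l : exit_time y r w = l%:E ->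
  0 <= l /\ r <= `|y + W l w|.
Proof.
move=> El; have l0 : 0 <= l by rewrite -lee_fin -El exit_time_ge0.
split=> //; rewrite -[X in W X w](ger0_norm l0).
have := @closed_first_time R [set x | r <= x] _ _ l (@closed_ge R r) (@dist_path_continuous y w) _ El; apply.
by move=> s [s0 rs]; rewrite /= [X in W X w]ger0_norm.
Qed.

(** The exit time is attained, since the constraint to leave is closed. *)
Lemma lt_exit_timeP y r t w : 0 <= t -> (t%:E < exit_time y r w)%E <->
  (forall s, 0 <= s <= t -> `|y + W s w| < r).
Proof.
move=> t0; split=> [tE s /andP[s0 st]|H].
  by apply: before_exit_time => //; rewrite (le_lt_trans _ tE)// lee_fin.
rewrite ltNge; apply/negP => Et.
have [l El] : exists l, exit_time y r w = l%:E.
  exists (fine (exit_time y r w)); rewrite fineK// ge0_fin_numE ?exit_time_ge0//.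
  by rewrite (le_lt_trans Et)// ltry.
have [l0 rl] := exit_time_attained El.
have /H : 0 <= l <= t by rewrite l0 -lee_fin -El.
by rewrite ltNge rl.
Qed.

(** A bound at all earlier times passes to the limit; the hypothesis at [0]
    serves when [l = 0]. *)
Lemma le_before_le_at (f : R -> R) (c l : R) : continuous f -> f 0 <= c -> 0 <= l ->
  (forall s, 0 < s < l -> f s <= c) -> f l <= c.
Proof.
move=> cf f0 l0 fs; have [<-//|l0'] := eqVneq 0 l.
have {l0' }l0 : 0 < l by rewrite lt_neqAle l0'.
rewrite leNgt; apply/negP => cfl.
have : nbhs (f l) [set x | c < x] by exact: lt_nbhsr.
move=> /(cf l)[e /= e0 es].
pose s := Num.max (l / 2) (l - e / 2).
have sl : s < l by rewrite gt_max ltr_pdivrMr// ltr_pMr// ltrBlDr ltrDl divr_gt0// ltr1n.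
have s0 : 0 < s by rewrite lt_max divr_gt0.
have := fs s; rewrite s0 sl => /(_ isT); rewrite leNgt => /negP; apply; apply: es.
have : l - e / 2 <= s by rewrite le_max lexx orbT.
by rewrite /ball/= ger0_norm ?subr_ge0 ?(ltW sl)//; lra.
Qed.

Lemma exit_time_eq y r w l : `|y| <= r -> exit_time y r w = l%:E ->
  `|y + W l w| = r.
Proof.
move=> yr El; have [l0 rl] := exit_time_attained El.
apply/eqP; rewrite eq_le rl andbT -[X in W X w](ger0_norm l0).
apply: (le_before_le_at (@dist_path_continuous y w)) => //=.
  by rewrite normr0 (bm_start BW) addr0.
move=> s /andP[s0 sl]; apply/ltW/before_exit_time => //.
by rewrite gtr0_norm// El lte_fin.
Qed.

Lemma measurable_exit_time y r : measurable_fun setT (exit_time y r).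
Proof.
apply: (measurability _ (ErealGenOInfty.measurableE R)) => // _ [_ [t ->] <-].
rewrite setTI; have [t0|t0] := leP 0 t; last first.
  rewrite (_ : _ @^-1` _ = setT)//; apply/seteqP; split => // w _ /=.
  by rewrite in_itv/= andbT (lt_le_trans _ (exit_time_ge0 _ _ _))// lte_fin.
rewrite (_ : _ @^-1` _ = [set w | forall s, 0 <= s <= t -> `|y + W s w| < r]).
  exact: measurable_survival.
by apply/seteqP; split => w /=; rewrite in_itv/= andbT => /lt_exit_timeP; exact.
Qed.

Definition capped_exit (y r N : R) (w : T) : R :=
  fine (Order.min (exit_time y r w) N%:E).

Lemma capped_exitE y r N w : 0 <= N ->
  (capped_exit y r N w)%:E = Order.min (exit_time y r w) N%:E.
Proof.
move=> N0; rewrite /capped_exit fineK// ge0_fin_numE.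
  by rewrite gt_min ltry orbT.
by rewrite le_min exit_time_ge0 lee_fin.
Qed.

Lemma capped_exit_ge0 y r N w : 0 <= N -> 0 <= capped_exit y r N w.
Proof. by move=> N0; rewrite -lee_fin capped_exitE// le_min exit_time_ge0 lee_fin. Qed.

Lemma capped_exit_le y r N w : 0 <= N -> capped_exit y r N w <= N.
Proof. by move=> N0; rewrite -lee_fin capped_exitE// ge_min lexx orbT. Qed.

Lemma capped_exit_bounded y r N w : `|y| <= r -> 0 <= N ->
  `|y + W (capped_exit y r N w) w| <= r.
Proof.
move=> yr N0; have c0 := @capped_exit_ge0 y r N w N0.
rewrite -[X in W X w](ger0_norm c0).
apply: (le_before_le_at (@dist_path_continuous y w)) => //=.
  by rewrite normr0 (bm_start BW) addr0.
move=> s /andP[s0]; rewrite -lte_fin capped_exitE// lt_min => /andP[sE _].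
by apply/ltW/before_exit_time; rewrite ?gtr0_norm// ltW.
Qed.

(** The exit time rounded up to the grid of step [dl] and stopped after [k]
    steps.  Whether it exceeds [k * dl] is decided by the path up to [k * dl],
    which is what makes stopping at this time a discrete sum. *)
Fixpoint rounded_exit (y r dl : R) (k : nat) (w : T) : R :=
  if k is k'.+1 then
    if ((k'%:R * dl)%:E < exit_time y r w)%E then k'.+1%:R * dl
    else rounded_exit y r dl k' w
  else 0.

Lemma rounded_exit_ge0 y r dl k w : 0 <= dl -> 0 <= rounded_exit y r dl k w.
Proof. by move=> dl0; elim: k => //= k IH; case: ifP => // _; rewrite mulr_ge0. Qed.

Lemma rounded_exit_le y r dl k w : 0 <= dl -> rounded_exit y r dl k w <= k%:R * dl.
Proof.
move=> dl0; elim: k => [|k IH] /=; first by rewrite mul0r.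
by case: ifP => // _; rewrite (le_trans IH)// ler_wpM2r// ler_nat.
Qed.

Lemma rounded_exit_close y r dl k w : 0 <= dl ->
  capped_exit y r (k%:R * dl) w <= rounded_exit y r dl k w
    <= capped_exit y r (k%:R * dl) w + dl.
Proof.
move=> dl0; have kd0 j : 0 <= j%:R * dl by rewrite mulr_ge0.
elim: k => [|k IH] /=.
  rewrite mul0r; have := @capped_exit_le y r 0 w (lexx 0).
  have := @capped_exit_ge0 y r 0 w (lexx 0).
  by move=> c0 c1; rewrite c1 addr_ge0.
case: ifPn => [kE|]; last first.
  rewrite -leNgt => Ek; suff -> : capped_exit y r (k.+1%:R * dl) w = capped_exit y r (k%:R * dl) w by [].
  apply: EFin_inj; rewrite !capped_exitE// !min_l//.
  by rewrite (le_trans Ek)// lee_fin ler_wpM2r// ler_nat.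
rewrite capped_exit_le//= -nat1r mulrDl mul1r addrC lerD2r.
rewrite -lee_fin capped_exitE ?addr_ge0// le_min (ltW kE) lee_fin.
by rewrite /= lerDl.
Qed.

Lemma rounded_exit_before y r dl k w : 0 <= dl ->
  ((k%:R * dl)%:E < exit_time y r w)%E -> rounded_exit y r dl k w = k%:R * dl.
Proof.
move=> dl0; case: k => [|k] kE /=; first by rewrite mul0r.
by rewrite (le_lt_trans _ kE)// lee_fin ler_wpM2r// ler_nat.
Qed.

Lemma measurable_rounded_value (V : R -> T -> R) y r dl k : 0 <= dl ->
  (forall s, 0 <= s -> measurable_fun setT (V s)) ->
  measurable_fun setT (fun w => V (rounded_exit y r dl k w) w).
Proof.
move=> dl0 mV; elim: k => [|k IH] /=; first exact: mV.
pose A := [set w | forall s, 0 <= s <= k%:R * dl -> `|y + W s w| < r].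
have kd0 : 0 <= k%:R * dl by rewrite mulr_ge0.
have mA : measurable A by exact: measurable_survival.
have -> : (fun w => V (if ((k%:R * dl)%:E < exit_time y r w)%E then k.+1%:R * dl
    else rounded_exit y r dl k w) w) =
  (fun w => if ((k%:R * dl)%:E < exit_time y r w)%E then V (k.+1%:R * dl) w
    else V (rounded_exit y r dl k w) w).
  by apply/funext => w; case: ifP.
apply: measurable_fun_ifT => //; last by apply: mV; rewrite mulr_ge0.
apply: (measurable_fun_bool true); rewrite setTI (_ : _ @^-1` _ = A)//.
by apply/seteqP; split => w /= /lt_exit_timeP; exact.
Qed.

(** Discrete optional stopping: one more step changes the stopped martingale
    only on the survival event, where its mean is preserved. *)
Lemma expectation_rounded_exp_mart th y r dl k : 0 < dl ->
  (\int[P]_w (exp_mart W th (rounded_exit y r dl k w) w)%:E = 1)%E.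
Proof.
move=> dl0; elim: k => [|k IH].
  under eq_integral do rewrite exp_mart0//.
  by rewrite integral_cst//= mul1e [LHS]probability_setT.
have kd0 : 0 <= k%:R * dl by rewrite mulr_ge0// ltW.
pose A := [set w | forall s, 0 <= s <= k%:R * dl -> `|y + W s w| < r].
have mA : measurable A by exact: measurable_survival.
pose Z j w := exp_mart W th (rounded_exit y r dl j w) w.
have mZ j : measurable_fun setT (EFin \o Z j).
  apply/measurable_EFinP; apply: (measurable_rounded_value (V := exp_mart W th)) => //.
    exact: ltW.
  by move=> s _; exact: measurable_exp_mart.
have split_A j : (\int[P]_w (Z j w)%:E =
    \int[P]_(w in A) (Z j w)%:E + \int[P]_(w in ~` A) (Z j w)%:E)%E.
  rewrite -[in LHS](setUv A) ge0_integral_setU//=.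
  - exact: measurableC.
  - by rewrite setUv; exact: mZ.
  - by move=> w _; rewrite lee_fin expR_ge0.
  - exact/disj_setPCl.
rewrite -IH !split_A; congr (_ + _)%E.
  transitivity (\int[P]_(w in A) (exp_mart W th (k%:R * dl + dl) w)%:E)%E.
    apply: eq_integral => w; rewrite inE => /(lt_exit_timeP _ _ _ kd0) kE.
    by rewrite /Z/= kE -nat1r mulrDl mul1r addrC.
  rewrite exp_mart_step//; apply: eq_integral => w; rewrite inE => /(lt_exit_timeP _ _ _ kd0) kE.
  by rewrite /Z rounded_exit_before// ltW.
apply: eq_integral => w; rewrite inE => nA; rewrite /Z/= ifF//.
by apply/negP => /(lt_exit_timeP _ _ _ kd0).
Qed.

End ExitTime.

(** * Optional stopping *)

Section BoundedConvergence.
Context d (T : measurableType d) (R : realType) (P : probability T R).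

Lemma bounded_convergence (f_ : nat -> T -> R) (f : T -> R) (c : R) :
  (forall n, measurable_fun setT (f_ n)) ->
  (forall w, f_ ^~ w @ \oo --> f w) ->
  (forall n w, `|f_ n w| <= c) ->
  (\int[P]_w (f_ n w)%:E)%E @[n --> \oo] --> (\int[P]_w (f w)%:E)%E.
Proof.
move=> mf_ f_f fc.
have mf : measurable_fun setT f.
  by apply: (measurable_fun_cvg mf_) => w _; exact: f_f.
have [] := @dominated_convergence _ _ _ P setT measurableT
   (fun n => EFin \o f_ n) (EFin \o f) (EFin \o cst c).
- by move=> n; exact/measurable_EFinP.
- exact/measurable_EFinP.
- by apply: aeW => w _; apply: cvg_EFin; [exact: nearW|exact: f_f].
- exact: finite_measure_integrable_cst.
- by apply: aeW => w n _; rewrite /= lee_fin.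
- by move=> _ _; exact.
Qed.

End BoundedConvergence.

Section Stopping.
Context d (T : measurableType d) (R : realType) (P : probability T R).
Variable W : R -> {RV P >-> R}.
Hypothesis BW : brownian_motion W.
Local Notation exit_time := (exit_time W).
Local Notation capped_exit := (capped_exit W).
Local Notation rounded_exit := (rounded_exit W).

Section CappedValue.
Variable V : R -> T -> R.
Hypothesis mV : forall s, 0 <= s -> measurable_fun setT (V s).
Hypothesis cV : forall w, continuous (fun s : R => V `|s| w).

Lemma cvg_rounded_value y r N w : 0 <= N ->
  (fun n => V (rounded_exit y r (N / n.+1%:R) n.+1 w) w) @ \oo -->
    V (capped_exit y r N w) w.
Proof.
move=> N0; set c := capped_exit y r N w.
have dl0 n : 0 <= N / n.+1%:R :> R by rewrite divr_ge0.
have c0 : 0 <= c by exact: capped_exit_ge0.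
have h : (fun n => rounded_exit y r (N / n.+1%:R) n.+1 w) @ \oo --> c.
  apply: (@squeeze_cvgr _ _ _ _ (cst c) (fun n => c + N * n.+1%:R^-1)).
  - apply: nearW => n; have := @rounded_exit_close _ _ _ _ W y r _ n.+1 w (dl0 n).
    by rewrite [X in capped_exit y r X](mulrC _ (N / _)) divfK// pnatr_eq0.
  - exact: cvg_cst.
  - rewrite -[X in _ --> X]addr0 -[X in _ --> _ + X](mulr0 N).
    apply: cvgD; first exact: cvg_cst.
    by apply: cvgM; [exact: cvg_cst|exact: cvg_harmonic].
have -> : (fun n => V (rounded_exit y r (N / n.+1%:R) n.+1 w) w) =
    (fun s => V `|s| w) \o (fun n => rounded_exit y r (N / n.+1%:R) n.+1 w).
  by apply/funext => n; rewrite /comp ger0_norm ?rounded_exit_ge0.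
rewrite -[X in V X w](ger0_norm c0); exact: (cvg_comp _ _ h (@cV w c)).
Qed.

Lemma measurable_capped_value y r N : 0 <= N ->
  measurable_fun setT (fun w => V (capped_exit y r N w) w).
Proof.
move=> N0; apply: (@measurable_fun_cvg _ _ _ _
  (fun n w => V (rounded_exit y r (N / n.+1%:R) n.+1 w) w)) => [n|w _].
  by apply: measurable_rounded_value => //; rewrite divr_ge0.
exact: cvg_rounded_value.
Qed.

End CappedValue.

Lemma exp_mart_continuous th w : continuous (fun s : R => exp_mart W th `|s| w).
Proof.
move=> s; apply: continuous_comp; last exact: continuous_expR.
apply: cvgB; apply: cvgM; try exact: cvg_cst; first exact: path_continuous.
by apply: cvg_norm; exact: cvg_id.
Qed.

Lemma exp_mart_le_stopped th y r s w : `|y| <= r -> 0 <= s ->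
  `|y + W s w| <= r -> exp_mart W th s w <= expR (`|th| * (r + r) - th ^+ 2 / 2 * s).
Proof.
move=> yr s0 yWr; rewrite ler_expR lerB//.
rewrite (le_trans (ler_norm _))// normrM ler_wpM2l//.
have -> : W s w = (y + W s w) - y by rewrite addrAC subrr add0r.
by rewrite (le_trans (ler_normB _ _))// lerD.
Qed.

(** The rounded exit times decrease to the capped one, but the martingale
    overshoots at rounded times, so there is no uniform bound.  It is bounded
    in square mean, because the square of the martingale of parameter [th] is
    at most [exp (th^2 N)] times the martingale of parameter [2 * th].  Hence
    truncating at [K] costs [O(1 / K)]. *)
Lemma expectation_capped_exp_mart th y r N : `|y| <= r -> 0 < N ->
  (\int[P]_w (exp_mart W th (capped_exit y r N w) w)%:E = 1)%E.
Proof.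
move=> yr N0; have N0' := ltW N0.
pose dl n : R := N / n.+1%:R.
have dl0 n : 0 < dl n by rewrite divr_gt0.
have dlN n : n.+1%:R * dl n = N by rewrite mulrC divfK// pnatr_eq0.
pose Z a n w := exp_mart W a (rounded_exit y r (dl n) n.+1 w) w.
have mZ a n : measurable_fun setT (Z a n).
  apply: (measurable_rounded_value BW (V := exp_mart W a)) => //; first exact: ltW.
  by move=> s _; exact: measurable_exp_mart.
have mM : measurable_fun setT (fun w => exp_mart W th (capped_exit y r N w) w).
  apply: (@measurable_capped_value (exp_mart W th)) => //.
    by move=> s _; exact: measurable_exp_mart.
  exact: exp_mart_continuous.
have EZ a n : (\int[P]_w (Z a n w)%:E = 1)%E by exact: expectation_rounded_exp_mart.
(* The bound on the second moment of the rounded martingale. *)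
pose C := expR (th ^+ 2 * N).
have ZC n w : Z th n w ^+ 2 <= C * Z (2 * th) n w.
  rewrite /Z /C /exp_mart -expRM_natl -expRD ler_expR.
  have := rounded_exit_le W y r n.+1 w (ltW (dl0 n)); rewrite dlN.
  set s := rounded_exit _ _ _ _ _ => sN.
  have : th ^+ 2 * s <= th ^+ 2 * N by rewrite ler_wpM2l// sqr_ge0.
  set u := W s w; lra.
(* A bound on the capped martingale; truncation at [K >= B] does not affect
   it. *)
pose B := expR (`|th| * (r + r)).
have B0 : 0 < B by exact: expR_gt0.
have MB w : exp_mart W th (capped_exit y r N w) w <= B.
  have c0 := @capped_exit_ge0 _ _ _ _ W y r N w N0'.
  rewrite (le_trans (exp_mart_le_stopped th yr c0 _)) ?capped_exit_bounded//.
  by rewrite ler_expR gerBl mulr_ge0// divr_ge0// sqr_ge0.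
have cvgmin K : B <= K -> (\int[P]_w (Num.min (Z th n w) K)%:E)%E @[n --> \oo] -->
    (\int[P]_w (exp_mart W th (capped_exit y r N w) w)%:E)%E.
  move=> BK; apply: (@bounded_convergence _ _ _ P _ _ K).
  - by move=> n; exact: measurable_minr.
  - move=> w; rewrite -[X in _ --> X](min_l (le_trans (MB w) BK)).
    have cmin (z : R) : {for z, continuous (fun x : R => Num.min x K)}.
      by apply: (@continuous_min R R id (cst K)); [exact: cvg_id|exact: cvg_cst].
    have hZ : (fun n => Z th n w) @ \oo --> exp_mart W th (capped_exit y r N w) w.
      apply: (@cvg_rounded_value (exp_mart W th)) => //.
      exact: exp_mart_continuous.
    exact: (cvg_comp _ _ hZ (@cmin _)).
  - move=> n w; rewrite ger0_norm ?ge_min ?lexx ?orbT//.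
    by rewrite le_min expR_ge0 (le_trans (ltW B0)).
have mmin n K : measurable_fun setT (fun w => (Num.min (Z th n w) K)%:E).
  by apply/measurable_EFinP; exact: measurable_minr.
have mZE a n : measurable_fun setT (fun w => (Z a n w)%:E) by exact/measurable_EFinP.
have minZ n K : 0 < K -> (\int[P]_w (Num.min (Z th n w) K)%:E <= 1)%E.
  move=> K0; rewrite -(EZ th n); apply: ge0_le_integral => //.
  - by move=> w _; rewrite lee_fin le_min expR_ge0 ltW.
  - by move=> w _; rewrite lee_fin ge_min lexx.
have Zmin n K : 0 < K -> (1 <= \int[P]_w (Num.min (Z th n w) K)%:E + (C / K)%:E)%E.
  move=> K0; have CK0 : 0 <= C / K by rewrite divr_ge0 ?expR_ge0// ltW.
  rewrite -(EZ th n) -[X in (_ + X)%E]mule1 -(EZ (2 * th) n) -ge0_integralZl//.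
  rewrite -ge0_integralD//; last 3 first.
  - by move=> w _; rewrite lee_fin le_min expR_ge0 ltW.
  - by move=> w _; rewrite lee_fin mulr_ge0// expR_ge0.
  - exact: emeasurable_funM.
  apply: ge0_le_integral => //.
  - by move=> w _; rewrite lee_fin expR_ge0.
  - by apply: emeasurable_funD => //; exact: emeasurable_funM.
  - move=> w _; rewrite -EFinM -EFinD lee_fin.
    have Z0 : 0 <= Z th n w by exact: expR_ge0.
    have CZ : Z th n w ^+ 2 / K <= C / K * Z (2 * th) n w.
      by rewrite [leRHS]mulrAC; apply: ler_wpM2r (ZC n w); rewrite invr_ge0 ltW.
    have [ZK|KZ] := leP (Z th n w) K.
      by rewrite lerDl (le_trans _ CZ)// divr_ge0 ?sqr_ge0 ?ltW.
    rewrite (le_trans _ (lerD (ltW K0) CZ))// add0r ler_pdivlMr// expr2.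
    by rewrite ler_wpM2l// ltW.
  by move=> w _; rewrite lee_fin expR_ge0.
apply/eqP; rewrite eq_le; apply/andP; split.
  apply: (cvge_to_le (cvgmin B (lexx _))) => //.
  by apply: nearW => n; exact: minZ.
apply/lee_addgt0Pr => e e0.
pose K := B + C / e.
have K0 : 0 < K by rewrite addr_gt0// divr_gt0// expR_gt0.
have CK : C / K <= e.
  rewrite ler_pdivrMr// /K mulrDr mulrCA divff ?gt_eqF// mulr1 lerDr.
  by rewrite mulr_ge0// ltW.
have cvgK : (\int[P]_w (Num.min (Z th n w) K)%:E + (C / K)%:E)%E @[n --> \oo] -->
    (\int[P]_w (exp_mart W th (capped_exit y r N w) w)%:E + (C / K)%:E)%E.
  apply: cvgeD; [exact: fin_num_adde_defl| |exact: cvg_cst].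
  by apply: cvgmin; rewrite lerDl divr_ge0 ?expR_ge0 ?ltW.
apply: (@le_trans _ _ (\int[P]_w (exp_mart W th (capped_exit y r N w) w)%:E + (C / K)%:E)%E).
  by apply: (cvge_to_ge cvgK); apply: nearW => n; exact: Zmin.
by rewrite leeD2l// lee_fin.
Qed.

End Stopping.

(** * The Laplace transform of the exit time *)

Section ExitLaplace.
Context d (T : measurableType d) (R : realType) (P : probability T R).
Variable W : R -> {RV P >-> R}.
Hypothesis BW : brownian_motion W.
Local Notation exit_time := (exit_time W).
Local Notation capped_exit := (capped_exit W).

(** The value 0 on the paths that never exit is the limit of the discounted
    quantities to which this is applied. *)
Definition exit_value (y r : R) (V : R -> T -> R) (w : T) : R :=
  if exit_time y r w is l%:E then V l w else 0.

Lemma exit_timeP y r w :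
  (exists2 l, 0 <= l & exit_time y r w = l%:E) \/ exit_time y r w = +oo%E.
Proof.
have := @exit_time_ge0 _ _ _ _ W y r w; case E : (exit_time y r w) => [l| |]//.
- by rewrite lee_fin => l0; left; exists l.
- by right.
Qed.

Lemma no_exit_bounded y r w s : exit_time y r w = +oo%E -> 0 <= s ->
  `|y + W s w| < r.
Proof. by move=> Ey s0; apply: before_exit_time => //; rewrite Ey ltry. Qed.

Section Limit.
Variables (y r : R) (V : R -> T -> R).
Hypothesis mV : forall s, 0 <= s -> measurable_fun setT (V s).
Hypothesis cV : forall w, continuous (fun s : R => V `|s| w).
Hypothesis V0 : forall w, exit_time y r w = +oo%E ->
  (fun n : nat => V n.+1%:R w) @ \oo --> (0 : R).

Lemma cvg_capped_value w :
  (fun n => V (capped_exit y r n.+1%:R w) w) @ \oo --> exit_value y r V w.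
Proof.
rewrite /exit_value; have [[l l0 El]|Ey] := exit_timeP y r w.
  rewrite El; apply: cvg_near_cst; exists (Num.truncn l) => // n /= ln.
  congr (V _ w); apply: EFin_inj; rewrite capped_exitE// El min_l// lee_fin.
  by rewrite ltW// (lt_le_trans (truncnS_gt _))// ler_nat.
rewrite Ey; have := V0 Ey; rewrite (_ : (fun n => V (capped_exit _ _ _ _) _) = fun n => V n.+1%:R w)//.
apply/funext => n; congr (V _ w); apply: EFin_inj; rewrite capped_exitE// Ey min_r//.
exact: leey.
Qed.

Lemma measurable_exit_value : measurable_fun setT (exit_value y r V).
Proof.
apply: (@measurable_fun_cvg _ _ _ _ (fun n w => V (capped_exit y r n.+1%:R w) w)).
  by move=> n; exact: measurable_capped_value.
by move=> w _; exact: cvg_capped_value.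
Qed.

End Limit.

Lemma stopped_exp_mart_cvg0 th y r w : `|y| <= r -> th != 0 ->
  exit_time y r w = +oo%E ->
  (fun n : nat => exp_mart W th n.+1%:R w) @ \oo --> (0 : R).
Proof.
move=> yr th0 Ey; set B := expR (`|th| * (r + r)).
have c0 : 0 < th ^+ 2 / 2 by rewrite divr_gt0// exprn_even_gt0.
have h : (fun n : nat => B * expR (- (th ^+ 2 / 2 * n.+1%:R))) @ \oo --> B * 0.
  apply: cvgM; first exact: cvg_cst.
  have n_oo : (n.+1%:R : R) @[n --> \oo] --> +oo%R.
    by have := @cvgr_idn R; rewrite -(cvg_shiftS (fun n => n%:R : R)).
  have c_oo : th ^+ 2 / 2 * x @[x --> +oo%R] --> +oo%R.
    by apply: gt0_cvgMry => //; exact: cvg_id.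
  have ce_oo := cvg_comp _ _ c_oo (@cvgr_expR R).
  exact: (cvg_comp _ _ n_oo ce_oo).
rewrite mulr0 in h; apply: squeeze_cvgr h => //; last exact: cvg_cst.
apply: nearW => n; rewrite expR_ge0/= -expRD.
by apply: (exp_mart_le_stopped th yr) => //; apply/ltW; exact: no_exit_bounded Ey _.
Qed.

(** Optional stopping at the exit time itself: the capped martingales are
    uniformly bounded, and they tend to 0 on the paths that never exit. *)
Lemma expectation_exit_exp_mart th y r : `|y| <= r -> th != 0 ->
  (\int[P]_w (exit_value y r (exp_mart W th) w)%:E = 1)%E.
Proof.
move=> yr th0.
have mV s : 0 <= s -> measurable_fun setT (exp_mart W th s).
  by move=> _; exact: measurable_exp_mart.
have := @bounded_convergence _ _ _ P
  (fun n w => exp_mart W th (capped_exit y r n.+1%:R w) w)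
  (exit_value y r (exp_mart W th)) (expR (`|th| * (r + r))).
move=> /(_ _ _ _)/cvg_lim <-//.
- apply/cvg_lim => //; apply: cvg_near_cst; apply: nearW => n.
  exact: expectation_capped_exp_mart.
- by move=> n; apply: measurable_capped_value => //; exact: exp_mart_continuous.
- move=> w; apply: cvg_capped_value => v Ev; exact: (stopped_exp_mart_cvg0 yr th0 Ev).
- move=> n w; rewrite ger0_norm ?expR_ge0//.
  have c0 := @capped_exit_ge0 _ _ _ _ W y r n.+1%:R w (ler0n _ _).
  rewrite (le_trans (exp_mart_le_stopped th yr c0 _)) ?capped_exit_bounded//.
  by rewrite ler_expR gerBl mulr_ge0// divr_ge0// sqr_ge0.
Qed.

Definition twice_cosh (z : R) : R := expR z + expR (- z).

Lemma twice_cosh_gt0 z : 0 < twice_cosh z.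
Proof. by rewrite addr_gt0 ?expR_gt0. Qed.

Lemma twice_cosh_norm z : twice_cosh `|z| = twice_cosh z.
Proof.
by case: ger0P => // _; rewrite /twice_cosh opprK addrC.
Qed.

Lemma ge0_expectation_lin (u v : R) (g h : T -> R) : 0 <= u -> 0 <= v ->
  (forall w, 0 <= g w) -> (forall w, 0 <= h w) ->
  measurable_fun setT g -> measurable_fun setT h ->
  (\int[P]_w (u * g w + v * h w)%:E =
   u%:E * \int[P]_w (g w)%:E + v%:E * \int[P]_w (h w)%:E)%E.
Proof.
move=> u0 v0 g0 h0 mg mh.
have mge : measurable_fun setT (EFin \o g) by exact/measurable_EFinP.
have mhe : measurable_fun setT (EFin \o h) by exact/measurable_EFinP.
rewrite -(ge0_integralZl P measurableT mge)//; last by move=> w _; rewrite lee_fin.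
rewrite -(ge0_integralZl P measurableT mhe)//; last by move=> w _; rewrite lee_fin.
rewrite -ge0_integralD//.
- by move=> w _; rewrite lee_fin mulr_ge0.
- exact: measurable_funeM.
- by move=> w _; rewrite lee_fin mulr_ge0.
- exact: measurable_funeM.
Qed.

(** A mean is read off a linear relation with two variables of mean 1.  All
    terms are nonnegative, and the term in [e] replaces a subtraction. *)
Lemma expectation_from_relation (a b c e : R) (f1 f2 f : T -> R) :
  0 <= a -> 0 <= b -> 0 < c -> 0 <= e ->
  (forall w, 0 <= f1 w) -> (forall w, 0 <= f2 w) -> (forall w, 0 <= f w) ->
  measurable_fun setT f1 -> measurable_fun setT f2 -> measurable_fun setT f ->
  (\int[P]_w (f1 w)%:E = 1)%E -> (\int[P]_w (f2 w)%:E = 1)%E ->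
  (forall w, c * f w + e * f1 w = a * f1 w + b * f2 w) ->
  (\int[P]_w (f w)%:E = ((a + b - e) / c)%:E)%E.
Proof.
move=> a0 b0 cp e0 f10 f20 f0 mf1 mf2 mf E1 E2 E; have c0 := ltW cp.
have := ge0_expectation_lin a0 b0 f10 f20 mf1 mf2.
under eq_integral do rewrite -E.
rewrite ge0_expectation_lin// E1 E2 !mule1.
set I := (\int[P]_w _)%E => cI.
have fI : I \is a fin_num.
  rewrite ge0_fin_numE; last by apply: integral_ge0 => w _; rewrite lee_fin.
  rewrite ltNge leye_eq; apply/negP => /eqP Ioo; move: cI; rewrite Ioo.
  by rewrite gt0_muley// addye// -EFinD.
move: cI; rewrite -(fineK fI) -EFinM -!EFinD => -[cI].
by congr EFin; rewrite -cI addrK mulrC mulKf// gt_eqF.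
Qed.

Lemma exit_exp_mart_ge0 th y r w : 0 <= exit_value y r (exp_mart W th) w.
Proof. by rewrite /exit_value; case: (exit_time y r w) => // l; exact: expR_ge0. Qed.

Lemma measurable_exit_exp_mart th y r : `|y| <= r -> th != 0 ->
  measurable_fun setT (exit_value y r (exp_mart W th)).
Proof.
move=> yr th0; apply: measurable_exit_value.
- by move=> s _; exact: measurable_exp_mart.
- exact: exp_mart_continuous.
- by move=> w Ew; exact: (stopped_exp_mart_cvg0 yr th0 Ew).
Qed.

Definition discount_factor (lam s : R) (w : T) : R := expR (- (lam * s)).

Definition discounted_place (m lam s : R) (w : T) : R :=
  (m + W s w) * expR (- (lam * s)).

Lemma cvg_discount_factor lam w : 0 < lam ->
  (fun n : nat => discount_factor lam n.+1%:R w) @ \oo --> (0 : R).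
Proof.
move=> lam0; have n_oo : (n.+1%:R : R) @[n --> \oo] --> +oo%R.
  by have := @cvgr_idn R; rewrite -(cvg_shiftS (fun n => n%:R : R)).
have c_oo : lam * x @[x --> +oo%R] --> +oo%R.
  by apply: gt0_cvgMry => //; exact: cvg_id.
exact: (cvg_comp _ _ n_oo (cvg_comp _ _ c_oo (@cvgr_expR R))).
Qed.

Lemma measurable_exit_discount y r lam : 0 < lam ->
  measurable_fun setT (exit_value y r (discount_factor lam)).
Proof.
move=> lam0; apply: measurable_exit_value.
- by move=> s _; exact: measurable_cst.
- move=> w s; apply: continuous_comp; last exact: continuous_expR.
  apply: cvgN; apply: cvgM; first exact: cvg_cst.
  by apply: cvg_norm; exact: cvg_id.
- by move=> w _; exact: cvg_discount_factor.
Qed.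

Lemma measurable_exit_place r m lam : 0 < lam ->
  measurable_fun setT (exit_value 0 r (discounted_place m lam)).
Proof.
move=> lam0; apply: measurable_exit_value.
- move=> s _; apply: measurable_funM => //; exact: measurable_funD.
- move=> w s; apply: cvgM.
    by apply: cvgD; [exact: cvg_cst|exact: path_continuous].
  apply: continuous_comp; last exact: continuous_expR.
  apply: cvgN; apply: cvgM; first exact: cvg_cst.
  by apply: cvg_norm; exact: cvg_id.
- move=> w Ew; apply: norm_cvg0; set B := `|m| + r.
  have h : (fun n : nat => B * discount_factor lam n.+1%:R w) @ \oo --> B * 0.
    by apply: cvgM; [exact: cvg_cst|exact: cvg_discount_factor].
  rewrite mulr0 in h; apply: squeeze_cvgr h => //; last exact: cvg_cst.
  apply: nearW => n; rewrite normr_ge0/= normrM (ger0_norm (expR_ge0 _)).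
  apply: ler_wpM2r; first exact: expR_ge0.
  rewrite (le_trans (ler_normD _ _))// lerD2l ltW//.
  have := @no_exit_bounded 0 r w n.+1%:R Ew (ler0n _ _).
  by rewrite add0r.
Qed.

(** At the exit time [|y + W| = r], so the sum of the martingales of parameters
    [th] and [- th], weighted by [exp (th y)] and [exp (- th y)], is the
    discount factor times a constant. *)
Lemma exit_laplace th y r : `|y| <= r -> 0 < th ->
  (\int[P]_w (exit_value y r (discount_factor (th ^+ 2 / 2)) w)%:E =
   (twice_cosh (th * y) / twice_cosh (th * r))%:E)%E.
Proof.
move=> yr th0; have thn0 : th != 0 by rewrite gt_eqF.
have thNn0 : - th != 0 by rewrite oppr_eq0.
have lam0 : 0 < th ^+ 2 / 2 by rewrite divr_gt0// exprn_gt0.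
rewrite (@expectation_from_relation (expR (th * y)) (expR (- (th * y)))
  (twice_cosh (th * r)) 0 (exit_value y r (exp_mart W th))
  (exit_value y r (exp_mart W (- th))))//.
- by rewrite subr0.
- exact: twice_cosh_gt0.
- by move=> w; exact: exit_exp_mart_ge0.
- by move=> w; exact: exit_exp_mart_ge0.
- by move=> w; rewrite /exit_value; case: (exit_time y r w) => // l; exact: expR_ge0.
- exact: measurable_exit_exp_mart.
- exact: measurable_exit_exp_mart.
- exact: measurable_exit_discount.
- exact: expectation_exit_exp_mart.
- exact: expectation_exit_exp_mart.
move=> w; rewrite /exit_value mul0r addr0.
case El: (exit_time y r w) => [l| |]; rewrite ?mulr0 ?addr0//.
have yWr := exit_time_eq BW yr El.
have -> : twice_cosh (th * r) = twice_cosh (th * (y + W l w)).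
  rewrite -yWr -[RHS]twice_cosh_norm normrM gtr0_norm//.
rewrite /discount_factor /exp_mart sqrrN /twice_cosh mulrDl -!expRD.
by congr (expR _ + expR _); ring.
Qed.

(** From the centre of the interval both sides are equally likely, even under
    an exponential weight on the exit time: at the exit, [m + W] is a
    combination of [exp (th W)] and [exp (- th W)]. *)
Lemma exit_laplace_place th m r : 0 < r -> r <= m -> 0 < th ->
  (\int[P]_w (exit_value 0 r (discounted_place m (th ^+ 2 / 2)) w)%:E =
   (m * (2 / twice_cosh (th * r)))%:E)%E.
Proof.
move=> r0 rm th0; have thn0 : th != 0 by rewrite gt_eqF.
have thNn0 : - th != 0 by rewrite oppr_eq0.
have lam0 : 0 < th ^+ 2 / 2 by rewrite divr_gt0// exprn_gt0.
have m0 : 0 <= m by rewrite (le_trans (ltW r0)).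
have yr : `|0 : R| <= r by rewrite normr0 ltW.
(* With [K = 2 cosh (th r)] and [S = 2 sinh (th r)], on exit [m + W] is
   [(m / K + r / S) exp (th W) + (m / K - r / S) exp (- th W)]. *)
pose S := expR (th * r) - expR (- (th * r)).
have S0 : 0 < S by rewrite subr_gt0 ltr_expR gt0_cp// mulr_gt0.
have K0 := twice_cosh_gt0 (th * r).
have rS0 : 0 <= r / S by rewrite divr_ge0 ?ltW.
have mK0 : 0 <= m / twice_cosh (th * r) by rewrite divr_ge0// ltW.
rewrite (@expectation_from_relation (m / twice_cosh (th * r))
  (m / twice_cosh (th * r) + r / S) 1 (r / S)
  (exit_value 0 r (exp_mart W (- th))) (exit_value 0 r (exp_mart W th)))//.
- by congr EFin; field; rewrite !gt_eqF.
- by rewrite addr_ge0.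
- by move=> w; exact: exit_exp_mart_ge0.
- by move=> w; exact: exit_exp_mart_ge0.
- move=> w; rewrite /exit_value; case El: (exit_time 0 r w) => [l| |]//.
  rewrite mulr_ge0 ?expR_ge0//; have := exit_time_eq BW yr El.
  rewrite add0r => /eqP; rewrite eqr_norml => /andP[/orP[]/eqP -> _].
    by rewrite addr_ge0// ltW.
  by rewrite subr_ge0.
- exact: measurable_exit_exp_mart.
- exact: measurable_exit_exp_mart.
- exact: measurable_exit_place.
- exact: expectation_exit_exp_mart.
- exact: expectation_exit_exp_mart.
move=> w; rewrite /exit_value mul1r.
case El: (exit_time 0 r w) => [l| |]; rewrite ?mulr0 ?addr0//.
have := exit_time_eq BW yr El; rewrite add0r => /eqP; rewrite eqr_norml.
rewrite /discounted_place /exp_mart sqrrN !expRD /S /twice_cosh.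
have := gt_eqF S0; have := gt_eqF K0; rewrite /S /twice_cosh.
set e := expR (- (_ * l)); set p := expR (th * r); set q := expR (- (th * r)).
move=> /negbT Kn0 /negbT Sn0 /andP[/orP[]/eqP -> _].
  by rewrite mulNr -/p -/q; field; rewrite Kn0 Sn0.
by rewrite mulrNN mulrN -/p -/q; field; rewrite Kn0 Sn0.
Qed.

End ExitLaplace.

(** * Hyperbolic discounting as a mixture of exponentials *)

Lemma twice_cosh0 (R : realType) : twice_cosh (0 : R) = 2.
Proof. by rewrite /twice_cosh oppr0 expR0. Qed.

Lemma twice_cosh_continuous (R : realType) : continuous (@twice_cosh R).
Proof.
move=> z; apply: cvgD; first exact: continuous_expR.
apply: continuous_comp; last exact: continuous_expR.
by apply: cvgN; exact: cvg_id.
Qed.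

Section ExponentialIntegrals.
Context (R : realType).
Local Notation mu := (@lebesgue_measure R).
Local Notation halfline := (`[0%R, +oo[%classic : set R).

Lemma integral_expRN (c : R) : 0 < c ->
  (\int[mu]_(s in halfline) (expR (- (c * s)))%:E = c^-1%:E)%E.
Proof.
move=> c0.
have mexp : measurable_fun setT (fun s : R => (expR (- (c * s)))%:E).
  apply/measurable_EFinP/measurableT_comp => //; apply: measurableT_comp => //.
have -> : (\int[mu]_(s in halfline) (expR (- (c * s)))%:E =
    c^-1%:E * \int[mu]_s (exponential_pdf c s)%:E)%E.
  have -> : (\int[mu]_s (exponential_pdf c s)%:E =
      \int[mu]_(s in halfline) (c%:E * (expR (- (c * s)))%:E))%E.
    rewrite [RHS]integral_mkcond; apply: eq_integral => s _.
    by rewrite /exponential_pdf !patchE; case: ifP => // _; rewrite mulNr EFinM.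
  rewrite ge0_integralZl//.
  - by rewrite muleA -EFinM mulVf ?gt_eqF// mul1e.
  - exact: measurable_funTS.
  - by rewrite lee_fin ltW.
by rewrite integral_exponential_pdf// mule1.
Qed.

End ExponentialIntegrals.

Section DiscountTonelli.
Context d (T : measurableType d) (R : realType) (P : probability T R).
Local Notation mu := (@lebesgue_measure R).
Local Notation halfline := (`[0%R, +oo[%classic : set R).

(** Tonelli, from [1 / (1 + beta t)] as the integral over [s >= 0] of
    [exp (- s) exp (- beta s t)]. *)
Lemma hyperbolic_mixture (beta : R) (H tau : T -> R) : 0 <= beta ->
  measurable_fun setT H -> measurable_fun setT tau ->
  (forall w, 0 <= H w) -> (forall w, 0 <= tau w) ->
  let G s := (\int[P]_w (H w * expR (- (beta * s * tau w)))%:E)%E in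
  measurable_fun setT (G : measurableTypeR R -> \bar R) /\
  (\int[P]_w (H w / (1 + beta * tau w))%:E =
   \int[mu]_(s in halfline) ((expR (- s))%:E * G s))%E.
Proof.
move=> beta0 mH mtau H0 tau0 G.
pose f (z : T * measurableTypeR R) : \bar R :=
  (H z.1 * expR (- (beta * z.2 * tau z.1)))%:E.
pose e (z : T * measurableTypeR R) : \bar R :=
  (expR (- z.2) * \1_(halfline) z.2)%:E.
have mf : measurable_fun setT f.
  apply/measurable_EFinP; apply: measurable_funM.
    by apply: (measurableT_comp mH); exact: measurable_fst.
  apply: measurableT_comp => //; apply: measurableT_comp => //.
  apply: measurable_funM; last by apply: (measurableT_comp mtau); exact: measurable_fst.
  by apply: measurable_funM => //; exact: measurable_snd.
have me : measurable_fun setT e.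
  apply/measurable_EFinP; apply: measurable_funM.
    apply: measurableT_comp => //; apply: measurableT_comp => //; exact: measurable_snd.
  apply: (measurableT_comp _ measurable_snd); exact: measurable_indic.
have f0 z : (0 <= f z)%E by rewrite lee_fin mulr_ge0 ?expR_ge0.
have e0 z : (0 <= e z)%E by rewrite lee_fin mulr_ge0 ?expR_ge0.
have mfe : measurable_fun setT (fun z => e z * f z)%E by exact: emeasurable_funM.
split; first exact: (measurable_fun_fubini_tonelli_G f).
transitivity (\int[P]_w \int[mu]_s (e (w, s) * f (w, s)))%E.
  apply: eq_integral => w _.
  have c0 : 0 < 1 + beta * tau w by rewrite ltr_pwDl// mulr_ge0.
  rewrite EFinM -(integral_expRN c0) -ge0_integralZl//.
  - rewrite [LHS]integral_mkcond; apply: eq_integral => s _.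
    rewrite patchE /e /f /= indicE; case: ifP => sI; last by rewrite mulr0 mul0e.
    rewrite mulr1 -!EFinM mulrCA -expRD; congr (_ * expR _)%:E.
    by ring.
  - apply/measurable_EFinP/measurable_funTS/measurableT_comp => //.
    exact: measurableT_comp.
  - by rewrite lee_fin.
rewrite (fubini_tonelli (fun z => e z * f z)%E)//; last by move=> z; rewrite mule_ge0.
rewrite [RHS]integral_mkcond; apply: eq_integral => s _.
rewrite patchE; under eq_integral do rewrite /e /=.
rewrite indicE; case: ifP => sI; last first.
  by rewrite integral0_eq// => w _; rewrite mulr0 mul0e.
rewrite mulr1 -ge0_integralZl//.
- exact: (measurableT_comp mf (measurable_pair2 s)).
- by move=> w _; rewrite lee_fin mulr_ge0 ?expR_ge0.
Qed.

End DiscountTonelli.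

Section ExitDiscount.
Context d (T : measurableType d) (R : realType) (P : probability T R).
Variable W : R -> {RV P >-> R}.
Hypothesis BW : brownian_motion W.
Variable beta : R.
Hypothesis beta0 : 0 < beta.
Local Notation mu := (@lebesgue_measure R).
Local Notation halfline := (`[0%R, +oo[%classic : set R).

(** The parameter whose exponential martingale discounts at rate [beta * s]. *)
Definition rate (s : R) : R := Num.sqrt (2 * beta * s).

Lemma rate_gt0 s : 0 < s -> 0 < rate s.
Proof. by move=> s0; rewrite sqrtr_gt0 !mulr_gt0. Qed.

Lemma rate_sqr s : 0 <= s -> rate s ^+ 2 = 2 * beta * s.
Proof. by move=> s0; rewrite sqr_sqrtr// !mulr_ge0// ltW. Qed.

Lemma rate_continuous : continuous rate.
Proof.
move=> s; apply: continuous_comp; last exact: sqrt_continuous.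
by apply: cvgM; [exact: cvg_cst|exact: cvg_id].
Qed.

(** A mean at the exit time that is known under all exponential discountings is
    known under the hyperbolic one. *)
Lemma exit_mixture y r (V : R -> T -> R) (L : R -> R) :
  measurable_fun setT (exit_value W y r (fun s w => V s w * expR (- (1 * s)))) ->
  (forall w, 0 <= exit_value W y r V w) ->
  (forall th, 0 < th -> (\int[P]_w
     (exit_value W y r (fun s w => V s w * expR (- (th ^+ 2 / 2 * s))) w)%:E =
     (L th)%:E)%E) ->
  measurable_fun setT (fun s => L (rate s)) ->
  (\int[P]_w (exit_value W y r (fun s w => V s w / (1 + beta * s)) w)%:E =
   \int[mu]_(s in halfline) (expR (- s) * L (rate s))%:E)%E.
Proof.
move=> mV V0 EL mL.
pose tau w := fine (exit_time W y r w).
have tau0 w : 0 <= tau w by apply: fine_ge0; exact: exit_time_ge0.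
have mtau : measurable_fun setT tau.
  by apply: measurableT_comp; [exact: fine_measurable|exact: measurable_exit_time].
have mH : measurable_fun setT (exit_value W y r V).
  rewrite (_ : exit_value W y r V = fun w =>
     exit_value W y r (fun s w => V s w * expR (- (1 * s))) w * expR (tau w)).
    by apply: measurable_funM => //; exact: measurableT_comp.
  apply/funext => w; rewrite /exit_value /tau.
  case: (exit_time W y r w) => [l| |] /=; rewrite ?mul0r//.
  by rewrite -mulrA -expRD mul1r addNr expR0 mulr1.
have [mG mix] := hyperbolic_mixture P (ltW beta0) mH mtau V0 tau0.
have stopE (g : R -> R) w : exit_value W y r V w * g (tau w) =
    exit_value W y r (fun s w => V s w * g s) w.
  rewrite /exit_value /tau; case: (exit_time W y r w) => [l| |] /=; by rewrite ?mul0r.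
under eq_integral do rewrite -(stopE (fun s => (1 + beta * s)^-1)).
rewrite mix -integral_itv_obnd_cbnd; last first.
  apply: measurable_funTS; apply: emeasurable_funM => //.
  by apply/measurable_EFinP; apply: measurableT_comp => //; exact: measurableT_comp.
rewrite -[RHS]integral_itv_obnd_cbnd; last first.
  apply/measurable_EFinP; apply: measurable_funTS; apply: measurable_funM => //.
  by apply: measurableT_comp => //; exact: measurableT_comp.
apply: eq_integral => s; rewrite inE/= in_itv/= andbT => s0.
rewrite EFinM -EL ?rate_gt0// rate_sqr ?ltW//; congr (_ * _)%E.
apply: eq_integral => w _; rewrite -(stopE (fun u => expR (- (2 * beta * s / 2 * u)))).
by congr (_ * expR (- _))%:E; field.
Qed.

Definition exit_ratio (y r s : R) : R :=
  twice_cosh (rate s * y) / twice_cosh (rate s * r).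

(** The mean discount factor at the exit of [y + W] from the interval of radius
    [r], by [exit_discount]. *)
Definition Phi (y r : R) : \bar R :=
  (\int[mu]_(s in halfline) (expR (- s) * exit_ratio y r s)%:E)%E.

Lemma measurable_exit_ratio y r : measurable_fun setT (exit_ratio y r).
Proof.
apply: continuous_measurable_fun => s.
have cK (c : R) : {for s, continuous (fun s => twice_cosh (rate s * c))}.
  have cr : {for s, continuous (fun s => rate s * c)}.
    by apply: cvgM; [exact: rate_continuous|exact: cvg_cst].
  exact: (cvg_comp _ _ cr (@twice_cosh_continuous _ _)).
apply: cvgM; first exact: cK.
by apply: cvgV; [rewrite gt_eqF// twice_cosh_gt0|exact: cK].
Qed.

Lemma exit_discount y r : `|y| <= r ->
  (\int[P]_w (exit_value W y r (fun s _ => 1 / (1 + beta * s)) w)%:E = Phi y r)%E.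
Proof.
move=> yr.
rewrite (exit_mixture (V := fun _ _ => 1) (L := fun th => twice_cosh (th * y) / twice_cosh (th * r)))//.
- have := @measurable_exit_discount _ _ _ _ W BW y r 1 ltr01.
  by congr measurable_fun; apply/funext => w; rewrite /exit_value; case: exit_time => // l; rewrite mul1r.
- by move=> w; rewrite /exit_value; case: exit_time.
- move=> th th0; rewrite -(exit_laplace BW yr th0); apply: eq_integral => w _.
  by rewrite /exit_value; case: exit_time => // l; rewrite mul1r.
- exact: measurable_exit_ratio.
Qed.

Lemma exit_place_discount m r : 0 < r -> r <= m ->
  (\int[P]_w (exit_value W 0 r (fun s w => (m + W s w) / (1 + beta * s)) w)%:E =
   m%:E * Phi 0 r)%E.
Proof.
move=> r0 rm; have m0 : 0 <= m by rewrite (le_trans (ltW r0)).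
have yr : `|0 : R| <= r by rewrite normr0 ltW.
rewrite (exit_mixture (V := fun s w => m + W s w)
  (L := fun th => m * (2 / twice_cosh (th * r)))).
- rewrite -ge0_integralZl//.
  + apply: eq_integral => s _; rewrite -EFinM /exit_ratio mulr0.
    by rewrite twice_cosh0 mulrCA.
  + apply/measurable_EFinP/measurable_funTS; apply: measurable_funM.
      by apply: measurableT_comp => //; exact: measurableT_comp.
    exact: measurable_exit_ratio.
  + by move=> s _; rewrite lee_fin mulr_ge0 ?expR_ge0// divr_ge0// ltW// twice_cosh_gt0.
- exact: measurable_exit_place.
- move=> w; rewrite /exit_value; case El: (exit_time W 0 r w) => [l| |]//.
  have := exit_time_eq BW yr El.
  rewrite add0r => /eqP; rewrite eqr_norml => /andP[/orP[]/eqP -> _].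
    by rewrite addr_ge0// ltW.
  by rewrite subr_ge0.
- by move=> th th0; exact: exit_laplace_place.
- apply: measurable_funM => //.
  have := measurable_exit_ratio 0 r.
  congr measurable_fun; apply/funext => s; rewrite /exit_ratio mulr0.
  by rewrite twice_cosh0.
Qed.

End ExitDiscount.

(** * The value of waiting for a cutoff *)

Section ExponentialInequalities.
Context (R : realType).
Implicit Types u v z x a b h th : R.

(** Both [1 + v] and [1 - exp v (1 - v)] are nonnegative; the claim is their
    product. *)
Lemma expR_sqr_ub v : 0 <= v -> expR v <= 1 + v + v ^+ 2 * expR v.
Proof.
move=> v0; have h : expR v * (1 - v) <= 1.
  by rewrite -[leRHS](expRxMexpNx_1 v) ler_wpM2l ?expR_ge0// expR_ge1Dx.
have : 0 <= (1 + v) * (1 - expR v * (1 - v)) by rewrite mulr_ge0 ?subr_ge0// addr_ge0.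
by move=> H; rewrite -subr_ge0; apply: le_trans H _; rewrite le_eqVlt; apply/orP; left; apply/eqP; ring.
Qed.

Lemma expRN_sqr_ub v : 0 <= v -> expR (- v) <= 1 - v + v ^+ 2.
Proof.
move=> v0; rewrite expRN.
have h : 0 < 1 + v by rewrite ltr_pwDl.
rewrite (@le_trans _ _ (1 + v)^-1)//.
  by rewrite lef_pV2 ?posrE ?expR_gt0// expR_ge1Dx.
rewrite -[leLHS]mul1r ler_pdivrMr//.
have v3 : 0 <= v ^+ 3 by rewrite exprn_ge0.
by rewrite -subr_ge0 (_ : _ - 1 = v ^+ 3)//; ring.
Qed.

Lemma ler_twice_cosh u v : 0 <= u -> u <= v -> twice_cosh u <= twice_cosh v.
Proof.
move=> u0 uv; rewrite -subr_ge0 /twice_cosh.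
have -> : expR v + expR (- v) - (expR u + expR (- u)) =
    (expR v - expR u) * (1 - expR (- (u + v))).
  have e1 : expR v * expR (- (u + v)) = expR (- u) by rewrite -expRD; congr expR; ring.
  have e2 : expR u * expR (- (u + v)) = expR (- v) by rewrite -expRD; congr expR; ring.
  by rewrite mulrBr mulr1 mulrBl e1 e2; ring.
rewrite mulr_ge0 ?subr_ge0 ?ler_expR// -[leRHS]expR0 ler_expR oppr_le0.
by rewrite addr_ge0// (le_trans u0).
Qed.

(** [2 cosh z - 2] is the square of [exp (z / 2) - exp (- z / 2)], which is at
    least [z / 2]. *)
Lemma twice_cosh_lb z : 0 <= z -> 2 + z ^+ 2 / 4 <= twice_cosh z.
Proof.
move=> z0; have v0 : 0 <= z / 2 by rewrite divr_ge0.
have h : z / 2 <= expR (z / 2) - expR (- (z / 2)).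
  have := expR_ge1Dx (z / 2).
  have : expR (- (z / 2)) <= 1 by rewrite -[leRHS]expR0 ler_expR oppr_le0.
  lra.
have : (z / 2) ^+ 2 <= (expR (z / 2) - expR (- (z / 2))) ^+ 2.
  by rewrite ler_sqr ?nnegrE// (le_trans v0).
rewrite sqrrB -!expRM_natl expRxMexpNx_1 /twice_cosh.
have -> : 2 * (z / 2) = z by field.
have -> : 2 * - (z / 2) = - z by field.
rewrite expr_div_n; lra.
Qed.

Lemma tanh_ge0 z : 0 <= z -> 0 <= tanh z.
Proof.
move=> z0; apply: divr_ge0; last by rewrite addr_ge0 ?expR_ge0.
by rewrite subr_ge0 ler_expR; lra.
Qed.

Lemma ler_tanh u v : u <= v -> tanh u <= tanh v.
Proof.
move=> uv; have K0 z : 0 < expR z + expR (- z) by exact: twice_cosh_gt0.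
rewrite /tanh ler_pdivrMr// mulrAC ler_pdivlMr// -subr_ge0.
have -> : (expR v - expR (- v)) * (expR u + expR (- u)) -
   (expR u - expR (- u)) * (expR v + expR (- v)) =
   2 * (expR v * expR (- u) - expR (- v) * expR u) by ring.
rewrite mulr_ge0// subr_ge0 -!expRD ler_expR; lra.
Qed.

(** The function [cosh] lies above its tangent at [th * a]. *)
Lemma ratio_lb a h th : 0 <= h -> 0 <= th ->
  1 - h * th * tanh (th * a) <= twice_cosh (th * (a - h)) / twice_cosh (th * a).
Proof.
move=> h0 th0; have K0 := twice_cosh_gt0 (th * a).
rewrite ler_pdivlMr// mulrBl mul1r /tanh -[X in _ * (_ / X)]/(twice_cosh (th * a)).
rewrite -mulrA divfK ?gt_eqF// /twice_cosh.
have e1 : expR (th * (a - h)) = expR (th * a) * expR (- (h * th)).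
  by rewrite -expRD; congr expR; ring.
have e2 : expR (- (th * (a - h))) = expR (- (th * a)) * expR (h * th).
  by rewrite -expRD; congr expR; ring.
rewrite e1 e2.
have h1 := ler_wpM2l (expR_ge0 (th * a)) (expR_ge1Dx (- (h * th))).
have h2 := ler_wpM2l (expR_ge0 (- (th * a))) (expR_ge1Dx (h * th)).
by apply: le_trans (lerD h1 h2); rewrite le_eqVlt; apply/orP; left; apply/eqP; ring.
Qed.

(** The second order counterpart of the tangent inequality. *)
Lemma ratio_ub a h th : 0 <= h -> h <= a -> 0 <= th ->
  twice_cosh (th * (a - h)) / twice_cosh (th * a) <=
    1 - h * th * tanh (th * a) + 2 * (h * th) ^+ 2.
Proof.
move=> h0 ha th0; have K0 := twice_cosh_gt0 (th * a).
rewrite ler_pdivrMr// mulrDl mulrBl mul1r /tanh -[X in _ * (_ / X)]/(twice_cosh (th * a)).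
rewrite -[_ * _ * (_ / _) * _]mulrA divfK ?gt_eqF// /twice_cosh.
have e1 : expR (th * (a - h)) = expR (th * a) * expR (- (h * th)).
  by rewrite -expRD; congr expR; ring.
have e2 : expR (- (th * (a - h))) = expR (- (th * a)) * expR (h * th).
  by rewrite -expRD; congr expR; ring.
have hth : 0 <= h * th by rewrite mulr_ge0.
have h1 := ler_wpM2l (expR_ge0 (th * a)) (expRN_sqr_ub hth).
have h2 := ler_wpM2l (expR_ge0 (- (th * a))) (expR_sqr_ub hth).
have h3 : expR (- (th * (a - h))) <= expR (th * a).
  rewrite ler_expR (@le_trans _ _ 0)// ?oppr_le0 mulr_ge0// ?subr_ge0//.
  exact: le_trans ha.
have h4 : (h * th) ^+ 2 * expR (- (th * (a - h))) <= (h * th) ^+ 2 * expR (th * a).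
  by rewrite ler_wpM2l// sqr_ge0.
have h5 : 0 <= (h * th) ^+ 2 * expR (- (th * a)) by rewrite mulr_ge0 ?sqr_ge0 ?expR_ge0.
rewrite -e1 -e2 in h1 h2 *.
have h2' : expR (- (th * (a - h))) <= expR (- (th * a)) * (1 + h * th) +
   (h * th) ^+ 2 * expR (- (th * (a - h))).
  by rewrite [in leRHS]e2; apply: le_trans h2 _; rewrite le_eqVlt; apply/orP; left; apply/eqP; ring.
move: h1 h2' h4 h5; set p := expR (th * a); set q := expR (- (th * a)).
set p' := expR _; set q' := expR _; set u := h * th; clear; nra.
Qed.

End ExponentialInequalities.

Section PhiProperties.
Context (R : realType).
Variable beta : R.
Hypothesis beta0 : 0 < beta.
Local Notation mu := (@lebesgue_measure R).
Local Notation halfline := (`[0%R, +oo[%classic : set R).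
Local Notation rate := (rate beta).
Local Notation exit_ratio := (exit_ratio beta).
Local Notation Phi := (Phi beta).

Lemma rate_ge0 s : 0 <= rate s. Proof. exact: sqrtr_ge0. Qed.

Lemma exit_ratio_ge0 y r s : 0 <= exit_ratio y r s.
Proof. by rewrite divr_ge0// ltW// twice_cosh_gt0. Qed.

Lemma exit_ratio_le1 y r s : `|y| <= r -> exit_ratio y r s <= 1.
Proof.
move=> yr; rewrite ler_pdivrMr ?twice_cosh_gt0// mul1r -twice_cosh_norm normrM.
rewrite ger0_norm ?rate_ge0// ler_twice_cosh// ?mulr_ge0 ?rate_ge0//.
by rewrite ler_wpM2l// rate_ge0.
Qed.

Lemma measurable_exp_exit_ratio y r :
  measurable_fun halfline (fun s => (expR (- s) * exit_ratio y r s)%:E).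
Proof.
apply/measurable_EFinP/measurable_funTS/measurable_funM.
  by apply: measurableT_comp => //; exact: measurableT_comp.
exact: measurable_exit_ratio.
Qed.

Lemma measurable_expRN : measurable_fun halfline (fun s : R => (expR (- s))%:E).
Proof.
apply/measurable_EFinP/measurable_funTS.
by apply: measurableT_comp => //; exact: measurableT_comp.
Qed.

Lemma integral_expRN1 : (\int[mu]_(s in halfline) (expR (- s))%:E = 1)%E.
Proof.
rewrite -[RHS]/(1%:E) -[in RHS]invr1 -integral_expRN//.
by apply: eq_integral => s _; rewrite mul1r.
Qed.

Lemma Phi_ge0 y r : (0 <= Phi y r)%E.
Proof.
apply: integral_ge0 => s _.
by rewrite lee_fin mulr_ge0 ?expR_ge0 ?exit_ratio_ge0.
Qed.

Lemma Phi_le1 y r : `|y| <= r -> (Phi y r <= 1)%E.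
Proof.
move=> yr; rewrite -integral_expRN1; apply: ge0_le_integral => //.
- by move=> s _; rewrite lee_fin mulr_ge0 ?expR_ge0 ?exit_ratio_ge0.
- exact: measurable_exp_exit_ratio.
- exact: measurable_expRN.
- by move=> s _; rewrite lee_fin ler_piMr ?expR_ge0 ?exit_ratio_le1.
Qed.

Lemma Phi_fin_num y r : `|y| <= r -> Phi y r \is a fin_num.
Proof.
by move=> yr; rewrite ge0_fin_numE ?Phi_ge0// (le_lt_trans (Phi_le1 yr))// ltry.
Qed.

Lemma Phi_diag r : Phi r r = 1%E.
Proof.
rewrite -integral_expRN1; apply: eq_integral => s _.
by rewrite /exit_ratio divff ?mulr1// gt_eqF// twice_cosh_gt0.
Qed.

(** By dominated convergence, as all the ratios are at most 1.  This continuity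
    replaces the regularity of Brownian paths at the boundary of the kernel. *)
Lemma Phi_right_continuous y r : `|y| <= r ->
  Phi y (r + n.+1%:R^-1) @[n --> \oo] --> Phi y r.
Proof.
move=> yr.
have [] := @dominated_convergence _ _ _ mu halfline (measurable_itv _)
  (fun n s => (expR (- s) * exit_ratio y (r + n.+1%:R^-1) s)%:E)
  (fun s => (expR (- s) * exit_ratio y r s)%:E) (fun s => (expR (- s))%:E).
- by move=> n; exact: measurable_exp_exit_ratio.
- exact: measurable_exp_exit_ratio.
- apply: aeW => s _; apply: cvg_EFin; first exact: nearW.
  apply: cvgM; first exact: cvg_cst.
  apply: cvgM; first exact: cvg_cst.
  apply: cvgV; first by rewrite gt_eqF// twice_cosh_gt0.
  have h : (fun n => rate s * (r + n.+1%:R^-1)) @ \oo --> rate s * r.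
    apply: cvgM; first exact: cvg_cst.
    rewrite -[X in _ --> X]addr0; apply: cvgD; first exact: cvg_cst.
    exact: cvg_harmonic.
  exact: (cvg_comp _ _ h (@twice_cosh_continuous _ _)).
- apply/integrableP; split; first exact: measurable_expRN.
  under eq_integral do rewrite gee0_abs ?lee_fin ?expR_ge0//.
  by rewrite integral_expRN1 ltry.
- apply: aeW => s n _; rewrite gee0_abs lee_fin.
    by rewrite ler_piMr ?expR_ge0// exit_ratio_le1// (le_trans yr)// lerDl.
  by rewrite mulr_ge0 ?expR_ge0 ?exit_ratio_ge0.
- by move=> h1 h2 h3; exact: h3.
Qed.

Lemma half_mean_bound (u : R) : 0 <= u -> (1 + u)^-1 <= (1 + expR (- u)) / 2.
Proof.
move=> u0; have c0 : 0 < 1 + u by rewrite ltr_pwDl.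
rewrite -[leLHS]mul1r ler_pdivrMr// mulrAC ler_pdivlMr// mul1r.
have [u1|u1] := leP u 1.
  have : (1 + u) * (1 - u) <= (1 + u) * expR (- u).
    by rewrite ler_wpM2l ?(ltW c0)// expR_ge1Dx.
  by nra.
have : 0 <= expR (- u) * (1 + u) by rewrite mulr_ge0 ?expR_ge0 ?(ltW c0).
by nra.
Qed.

(** The ratio is at most [1 / (1 + c s)], hence at most
    [(1 + exp (- c s)) / 2], whose integral against [exp (- s)] is explicit. *)
Lemma Phi0_lt1 r : 0 < r -> (Phi 0 r < 1)%E.
Proof.
move=> r0; pose c := beta * r ^+ 2 / 4.
have c0 : 0 < c by rewrite divr_gt0// mulr_gt0// exprn_gt0.
have c1 : 0 < 1 + c by rewrite addr_gt0.
apply: (@le_lt_trans _ _ (2^-1 + 2^-1 * (1 + c)^-1)%:E); last first.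
  rewrite lte_fin; have : (1 + c)^-1 < 1 by rewrite invf_lt1// ltrDl.
  lra.
have me (k : R) : measurable_fun halfline (fun s => (expR (- (k * s)))%:E).
  apply/measurable_EFinP/measurable_funTS.
  by apply: measurableT_comp => //; apply: measurableT_comp => //.
have half0 (k : R) s : (0 <= 2^-1%:E * (expR (- (k * s)))%:E :> \bar R)%E.
  by rewrite lee_fin mulr_ge0 ?expR_ge0.
have mh (k : R) : measurable_fun halfline (fun s => 2^-1%:E * (expR (- (k * s)))%:E)%E.
  by apply: measurable_funeM; exact: me.
have -> : (2^-1 + 2^-1 * (1 + c)^-1)%:E =
    (\int[mu]_(s in halfline)
      (2^-1%:E * (expR (- (1 * s)))%:E + 2^-1%:E * (expR (- ((1 + c) * s)))%:E))%E.
  rewrite ge0_integralD//; [|exact: mh..].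
  rewrite !ge0_integralZl ?lee_fin ?invr_ge0//; [|exact: me..].
  by rewrite !integral_expRN// -!EFinM -EFinD invr1 mulr1.
apply: ge0_le_integral => //.
- by move=> s _; rewrite lee_fin mulr_ge0 ?expR_ge0 ?exit_ratio_ge0.
- exact: measurable_exp_exit_ratio.
- by apply: emeasurable_funD; exact: mh.
move=> s; rewrite /= in_itv/= andbT => s0.
have cs0 : 0 <= c * s by rewrite mulr_ge0// ltW.
rewrite -!EFinM -EFinD lee_fin.
have -> : 2^-1 * expR (- (1 * s)) + 2^-1 * expR (- ((1 + c) * s)) =
    expR (- s) * ((1 + expR (- (c * s))) / 2).
  have -> : expR (- ((1 + c) * s)) = expR (- s) * expR (- (c * s)).
    by rewrite -expRD; congr expR; ring.
  by rewrite mul1r; field.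
rewrite ler_wpM2l ?expR_ge0// (le_trans _ (half_mean_bound cs0))//.
rewrite /exit_ratio mulr0 twice_cosh0 ler_pdivrMr ?twice_cosh_gt0//.
rewrite ler_pdivlMl ?ltr_pwDl//.
have := twice_cosh_lb (mulr_ge0 (rate_ge0 s) (ltW r0)).
rewrite exprMn rate_sqr// /c; lra.
Qed.

Variable astar : R.
Hypothesis astar0 : 0 < astar.
Hypothesis astarE : (astar%:E * \int[mu]_(s in halfline)
     (expR (- s) * Num.sqrt (2 * beta * s)
        * tanh (astar * Num.sqrt (2 * beta * s)))%:E = 1)%E.

Local Notation slope s :=
  (expR (- s) * rate s * tanh (rate s * astar)).

Lemma slope_ge0 s : 0 <= slope s.
Proof.
apply: mulr_ge0; first by rewrite mulr_ge0 ?expR_ge0 ?rate_ge0.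
by apply: tanh_ge0; rewrite mulr_ge0 ?rate_ge0 ?ltW.
Qed.

Lemma measurable_slope : measurable_fun halfline (fun s => (slope s)%:E).
Proof.
apply/measurable_EFinP/measurable_funTS; apply: continuous_measurable_fun => s.
have cr : {for s, continuous (fun s => rate s * astar)}.
  by apply: cvgM; [exact: rate_continuous|exact: cvg_cst].
have cN : {for s, continuous (fun s => - (rate s * astar))} by exact: cvgN.
have ce := cvg_comp _ _ cr (@continuous_expR R _).
have cNe := cvg_comp _ _ cN (@continuous_expR R _).
have c1 : {for s, continuous (fun s : R => expR (- s))}.
  by apply: continuous_comp; [apply: cvgN; exact: cvg_id|exact: continuous_expR].
have c2 : {for s, continuous rate} by exact: rate_continuous.
have cS : {for s, continuous (fun s => expR (rate s * astar) - expR (- (rate s * astar)))}.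
  by apply: cvgB; [exact: ce|exact: cNe].
have cK : {for s, continuous (fun s => expR (rate s * astar) + expR (- (rate s * astar)))}.
  by apply: cvgD; [exact: ce|exact: cNe].
have K0 : expR (rate s * astar) + expR (- (rate s * astar)) != 0.
  by have := twice_cosh_gt0 (rate s * astar); rewrite lt0r => /andP[].
have c3 : {for s, continuous (fun s => tanh (rate s * astar))}.
  by apply: cvgM; [exact: cS|apply: cvgV; [exact: K0|exact: cK]].
by apply: cvgM; [apply: cvgM; [exact: c1|exact: c2]|exact: c3].
Qed.

Lemma integral_slope : (\int[mu]_(s in halfline) (slope s)%:E = astar^-1%:E)%E.
Proof.
have -> : (\int[mu]_(s in halfline) (slope s)%:E = \int[mu]_(s in halfline)
     (expR (- s) * Num.sqrt (2 * beta * s)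
        * tanh (astar * Num.sqrt (2 * beta * s)))%:E)%E.
  by apply: eq_integral => s _; rewrite [_ * astar]mulrC.
move: astarE; set I := (\int[mu]_(s in _) _)%E => aI.
have fI : I \is a fin_num.
  move: aI; case: I => [?| |]//; first by rewrite gt0_muley.
  by rewrite gt0_muleNy.
move: aI; rewrite -(fineK fI) -EFinM => -[aI]; congr EFin.
by rewrite -[LHS]mul1r -(mulVf (negbT (gt_eqF astar0))) -mulrA aI mulr1.
Qed.

Lemma integral_scaled_slope (h : R) : 0 <= h ->
  (\int[mu]_(s in halfline) (h%:E * (slope s)%:E) = (h / astar)%:E)%E.
Proof.
move=> h0; rewrite ge0_integralZl//.
- by rewrite integral_slope.
- exact: measurable_slope.
- by move=> s _; rewrite lee_fin slope_ge0.
Qed.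

(** The tangent inequality at [a], integrated: the slope of
    [x |-> a * Phi x a] at [a] is at most [a / astar <= 1], since [tanh] is
    nondecreasing. *)
Lemma place_le_waiting x a : 0 <= x -> x <= a -> a <= astar ->
  (x%:E <= a%:E * Phi x a)%E.
Proof.
move=> x0 xa aastar; have a0 : 0 <= a by exact: le_trans xa.
have h0 : 0 <= a - x by rewrite subr_ge0.
have xa' : `|x| <= a by rewrite ger0_norm.
have key : (1 <= Phi x a + ((a - x) / astar)%:E)%E.
  rewrite -integral_expRN1 -integral_scaled_slope// -ge0_integralD//.
  - apply: ge0_le_integral => //.
    + exact: measurable_expRN.
    + apply: emeasurable_funD; first exact: measurable_exp_exit_ratio.
      by apply: measurable_funeM; exact: measurable_slope.
    + move=> s _; rewrite -EFinM -EFinD lee_fin.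
      have := ratio_lb a h0 (rate_ge0 s); rewrite subKr -/(exit_ratio x a s) => lb.
      have ta : tanh (rate s * a) <= tanh (rate s * astar).
        by rewrite ler_tanh// ler_wpM2l// rate_ge0.
      have := ler_wpM2l (mulr_ge0 h0 (rate_ge0 s)) ta => ta'.
      have H := ler_wpM2l (expR_ge0 (- s)) (le_trans (lerB (lexx 1) ta') lb).
      rewrite -subr_ge0 in H; rewrite -subr_ge0; apply: le_trans H _.
      by rewrite le_eqVlt; apply/orP; left; apply/eqP; ring.
  - by move=> s _; rewrite lee_fin mulr_ge0 ?expR_ge0 ?exit_ratio_ge0.
  - exact: measurable_exp_exit_ratio.
  - by move=> s _; rewrite -EFinM lee_fin mulr_ge0// slope_ge0.
  - by apply: measurable_funeM; exact: measurable_slope.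
move: key; rewrite -(fineK (Phi_fin_num xa')) -EFinD -EFinM !lee_fin => key.
have h1 := ler_wpM2l a0 key.
have h2 : a * ((a - x) / astar) <= a - x.
  by rewrite mulrA ler_pdivrMr// mulrC ler_wpM2l.
rewrite mulr1 mulrDr in h1; lra.
Qed.

(** The slope at [a] now exceeds [1]: to first order in [h = a - x] waiting
    loses [h (a / astar - 1)], and the second order term is at most [a C h^2]. *)
Lemma waiting_lt_place a : astar < a ->
  exists x, [/\ 0 <= x, x < a & (a%:E * Phi x a < x%:E)%E].
Proof.
move=> aastar; have a0 : 0 < a by exact: lt_trans aastar.
pose C := 2 * (2 * beta * 4).
have C0 : 0 < C by rewrite !mulr_gt0.
pose D := a / astar - 1.
have D0 : 0 < D by rewrite subr_gt0 ltr_pdivlMr// mul1r.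
(* Half of the step at which the second order term balances the first. *)
pose h := Num.min a (D / (2 * (a * C))).
have h0 : 0 < h by rewrite lt_min a0 divr_gt0// !mulr_gt0.
have ha : h <= a by rewrite ge_min lexx.
have hD : a * C * h < D.
  rewrite (@le_lt_trans _ _ (a * C * (D / (2 * (a * C)))))//.
    by rewrite ler_wpM2l ?ge_min ?lexx ?orbT// mulr_ge0 ?ltW.
  have aC0 : a * C != 0 by rewrite gt_eqF// mulr_gt0.
  rewrite (_ : a * C * (D / (2 * (a * C))) = D / 2); first by lra.
  by field; rewrite (gt_eqF a0) (gt_eqF C0).
have x0 : 0 <= a - h by rewrite subr_ge0.
have xa : `|a - h| <= a by rewrite ger0_norm// gerBl ltW.
exists (a - h); split=> //; first by rewrite gtrBl.
(* The second order term carries [s exp (- s) <= 2 exp (- s / 2)]. *)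
have mhalf : measurable_fun halfline (fun s : R => (expR (- (2^-1 * s)))%:E).
  apply/measurable_EFinP/measurable_funTS.
  by apply: measurableT_comp => //; apply: measurableT_comp.
have C2 : 0 <= 2 * h ^+ 2 * (2 * beta * 2) by rewrite !mulr_ge0 ?(ltW h0) ?(ltW beta0)//.
have mh2 : measurable_fun halfline
    (fun s => (2 * h ^+ 2 * (2 * beta * 2))%:E * (expR (- (2^-1 * s)))%:E)%E.
  by apply: measurable_funeM; exact: mhalf.
have p2 s : (0 <= (2 * h ^+ 2 * (2 * beta * 2))%:E * (expR (- (2^-1 * s)))%:E :> \bar R)%E.
  by rewrite lee_fin mulr_ge0 ?expR_ge0.
have key : (Phi (a - h) a + (h / astar)%:E <= (1 + C * h ^+ 2)%:E)%E.
  have -> : (1 + C * h ^+ 2)%:E = (\int[mu]_(s in halfline) ((expR (- s))%:E +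
      (2 * h ^+ 2 * (2 * beta * 2))%:E * (expR (- (2^-1 * s)))%:E))%E.
    rewrite ge0_integralD//; [|exact: measurable_expRN].
    rewrite ge0_integralZl//.
    rewrite integral_expRN1 integral_expRN ?invr_gt0// -EFinM -EFinD invrK /C.
    by congr (1 + _)%:E; ring.
  rewrite -(integral_scaled_slope (ltW h0)) -ge0_integralD//.
  - apply: ge0_le_integral => //.
    + move=> s _; rewrite -EFinM -EFinD lee_fin addr_ge0//.
        by rewrite mulr_ge0 ?expR_ge0 ?exit_ratio_ge0.
      by rewrite mulr_ge0 ?slope_ge0 ?ltW.
    + apply: emeasurable_funD; first exact: measurable_exp_exit_ratio.
      by apply: measurable_funeM; exact: measurable_slope.
    + by apply: emeasurable_funD; [exact: measurable_expRN|exact: mh2].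
    + move=> s; rewrite /= in_itv/= andbT => s0; rewrite -!EFinM -!EFinD lee_fin.
      have := ratio_ub (ltW h0) ha (rate_ge0 s).
      rewrite -/(exit_ratio (a - h) a s) exprMn rate_sqr// => ub.
      have ta : tanh (rate s * astar) <= tanh (rate s * a).
        by rewrite ler_tanh// ler_wpM2l ?rate_ge0// ltW.
      have ta' := ler_wpM2l (mulr_ge0 (ltW h0) (rate_ge0 s)) ta.
      have ub' : exit_ratio (a - h) a s + h * rate s * tanh (rate s * astar) <=
          1 + 2 * (h ^+ 2 * (2 * beta * s)) by lra.
      have := ler_wpM2l (expR_ge0 (- s)) ub'.
      have se : expR (- s) * s <= 2 * expR (- (2^-1 * s)).
        have -> : expR (- (2^-1 * s)) = expR (- s) * expR (s / 2).
          by rewrite -expRD; congr expR; field.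
        rewrite mulrCA ler_wpM2l ?expR_ge0//; have := expR_ge1Dx (s / 2); lra.
      have k0 : 0 <= 2 * h ^+ 2 * (2 * beta) by rewrite !mulr_ge0 ?(ltW h0) ?(ltW beta0)//.
      have := ler_wpM2l k0 se.
      set e1 := expR (- s); set e2 := expR _; set t := tanh _; set q := exit_ratio _ _ _.
      move=> H1 H2.
      have E1 : e1 * (q + h * rate s * t) = e1 * q + h * (e1 * rate s * t) by ring.
      have E2 : e1 * (1 + 2 * (h ^+ 2 * (2 * beta * s))) =
        e1 + 2 * h ^+ 2 * (2 * beta) * (e1 * s) by ring.
      have E3 : 2 * h ^+ 2 * (2 * beta) * (2 * e2) = 2 * h ^+ 2 * (2 * beta * 2) * e2 by ring.
      by rewrite E1 E2 in H2; rewrite E3 in H1; apply: le_trans H2 _; rewrite lerD2l.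
  - by move=> s _; rewrite lee_fin mulr_ge0 ?expR_ge0 ?exit_ratio_ge0.
  - exact: measurable_exp_exit_ratio.
  - by move=> s _; rewrite -EFinM lee_fin mulr_ge0 ?slope_ge0 ?ltW.
  - by apply: measurable_funeM; exact: measurable_slope.
move: key; rewrite -(fineK (Phi_fin_num xa)) -EFinD -EFinM lee_fin lte_fin => key.
have h1 := ler_wpM2l (ltW a0) key.
have h2 : a * (h / astar) = h + D * h by rewrite /D; field; rewrite gt_eqF.
have h3 : a * C * h * h < D * h by rewrite ltr_pM2r.
by rewrite mulrDr h2 in h1; move: h1 h3; rewrite expr2; lra.
Qed.

End PhiProperties.

(** * Growth of the paths *)

Section GrowthOfPaths.
Context d (T : measurableType d) (R : realType) (P : probability T R).

Lemma ge0_markov (A : set T) (f : T -> R) (dl : R) : 0 <= dl -> measurable A ->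
  measurable_fun setT f -> (forall w, 0 <= f w) -> (forall w, A w -> dl <= f w) ->
  (dl%:E * P A <= \int[P]_w (f w)%:E)%E.
Proof.
move=> dl0 mA mf f0 Af.
have mI : measurable_fun setT (fun w => (\1_A w : R)%:E).
  exact/measurable_EFinP/measurable_indic.
rewrite -[X in (_ * P X)%E]setIT -integral_indic// -ge0_integralZl//.
apply: ge0_le_integral => //.
- by move=> w _; rewrite -EFinM lee_fin mulr_ge0.
- exact: measurable_funeM.
- exact/measurable_EFinP.
move=> w _; rewrite -EFinM lee_fin indicE.
case: (boolP (w \in A)) => [|_]; last by rewrite mulr0.
by rewrite inE mulr1 => /Af.
Qed.

Variable W : R -> {RV P >-> R}.
Hypothesis BW : brownian_motion W.

Lemma measurable_exit_before y r t :
  measurable [set w | (exit_time W y r w <= t%:E)%E].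
Proof.
rewrite -[X in measurable X]setTI; apply: emeasurable_fun_infty_c => //.
exact: measurable_exit_time.
Qed.

(** Markov's inequality for the discount factor of rate [1 / 2] at the exit
    time. *)
Lemma early_exit_prob (n : nat) :
  (P [set w | (exit_time W 0 (2 * n.+1%:R) w <= n.+1%:R%:E)%E] <=
   (4 / (2 ^ n.+1)%:R)%:E)%E.
Proof.
set N : R := n.+1%:R; have N0 : 0 < N by exact: ltr0n.
set r := 2 * N; have r0 : 0 <= r by rewrite mulr_ge0// ltW.
have yr : `|0 : R| <= r by rewrite normr0.
have := @ge0_markov [set w | (exit_time W 0 r w <= N%:E)%E]
  (exit_value W 0 r (discount_factor (1 ^+ 2 / 2))) (expR (- (1 ^+ 2 / 2 * N)))
  (expR_ge0 _) (@measurable_exit_before _ _ _).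
rewrite exit_laplace// mulr0 twice_cosh0 mul1r => H.
have {}H : ((expR (- (1 ^+ 2 / 2 * N)))%:E * P [set w | (exit_time W 0 r w <= N%:E)%E] <=
    (2 / twice_cosh r)%:E)%E.
  apply: H.
  - by apply: measurable_exit_discount => //; rewrite expr1n divr_gt0.
  - by move=> w; rewrite /exit_value; case: exit_time => // l; exact: expR_ge0.
  - move=> w /=; rewrite /exit_value; have := @exit_time_ge0 _ _ _ _ W 0 r w.
    case: exit_time => [l| |]//; rewrite !lee_fin => l0 lN.
    by rewrite /discount_factor ler_expR lerN2 ler_wpM2l// expr1n divr_ge0.
move: H; have fP : P [set w | (exit_time W 0 r w <= N%:E)%E] \is a fin_num.
  by apply: fin_num_measure; exact: measurable_exit_before.
rewrite -(fineK fP) -EFinM !lee_fin expr1n => H.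
set p := fine _ in H *.
have e2 : 2 <= expR 1 :> R by have := expR_ge1Dx (1 : R); lra.
have e2N : 2 ^+ n.+1 <= expR N.
  by rewrite /N -[n.+1%:R]mulr1 expRM_natl lerXn2r// nnegrE ?expR_ge0.
rewrite natrX ler_pdivlMr ?exprn_gt0//.
have H2 : p <= 2 / twice_cosh r * expR (1 / 2 * N).
  by rewrite -ler_pdivrMr ?expR_gt0// -expRN mulrC.
have p0 : 0 <= p by apply: fine_ge0.
rewrite (@le_trans _ _ (p * expR N))//; first by rewrite ler_wpM2l.
rewrite (@le_trans _ _ (2 / twice_cosh r * expR (1 / 2 * N) * expR N))//.
  by rewrite ler_wpM2r ?expR_ge0.
rewrite -mulrA -expRD mulrAC ler_pdivrMr ?twice_cosh_gt0//.
have h1 : expR (1 / 2 * N + N) <= expR r by rewrite ler_expR /r; lra.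
have h2 : expR r <= twice_cosh r by rewrite lerDl expR_ge0.
have := expR_ge0 (1 / 2 * N + N); lra.
Qed.

(** By Borel-Cantelli almost every path stays, for all large [n], in
    [[-2n, 2n]] up to time [n]. *)
Lemma ae_linear_growth :
  {ae P, forall w, exists n0 : nat, forall s, n0%:R <= s -> `|W s w| <= 2 * (s + 1)}.
Proof.
pose F n := [set w | (exit_time W 0 (2 * n.+1%:R) w <= n.+1%:R%:E)%E].
have mF n : measurable (F n) by exact: measurable_exit_before.
have F0 : P (lim_sup_set F) = 0.
  apply: lim_sup_set_cvg0 => //.
  apply: (@le_lt_trans _ _ 4%:E); last exact: ltry.
  apply: le_trans (@epsilon_trick0 R 4 xpredT _) => //.
  by apply: lee_nneseries => // n _; exact: early_exit_prob.
have mL : measurable (lim_sup_set F).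
  by apply: bigcap_measurable => // n _; exact: bigcup_measurable.
exists (lim_sup_set F); split => // w nw n _.
apply: contrapT => nF; apply: nw; exists n => s ns.
have s0 : 0 <= s by rewrite (le_trans _ ns).
pose k := Num.truncn s.
have /andP[k1 k2] := truncn_itv s0.
have nk : (n <= k)%N by rewrite truncn_ge_nat.
have : ~ F k w by move=> Fk; apply: nF; exists k.
rewrite /F /= => /negP; rewrite -ltNge => kE.
have := before_exit_time s0 (lt_trans _ kE); rewrite lte_fin => /(_ k2).
rewrite add0r => /ltW/le_trans; apply.
by rewrite ler_wpM2l// -natr1 lerD2r.
Qed.

End GrowthOfPaths.

(** * Payoffs and hitting times *)

Section Payoff.
Context d (T : measurableType d) (R : realType) (P : probability T R).
Variable W : R -> {RV P >-> R}.
Hypothesis BW : brownian_motion W.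
Variable beta : R.
Hypothesis beta0 : 0 < beta.
Local Notation payoff := (payoff_at W beta).
Local Notation Phi := (Phi beta).

Lemma limf_esup_pinfty_le (f : R -> \bar R) (c : \bar R) (s0 : R) :
  (forall s, s0 <= s -> (f s <= c)%E) -> (limf_esup f (pinfty_nbhs R) <= c)%E.
Proof.
move=> fc; rewrite limf_esupE.
apply: (@le_trans _ _ (ereal_sup (f @` [set s | s0 <= s]))).
  apply: ereal_inf_lbound; exists [set s | s0 <= s] => //.
  exists s0; split; first exact: num_real.
  by move=> s /ltW.
by apply: ge_ereal_sup => _ [s ss <-]; exact: fc.
Qed.

Lemma discounted_payoff_ge0 x s w : 0 <= s -> 0 <= discounted_payoff W beta x s w.
Proof.
move=> s0; apply: divr_ge0; first exact: normr_ge0.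
by rewrite addr_ge0// mulr_ge0// ltW.
Qed.

Lemma payoff_ge0 x t w : (0 <= t)%E -> (0 <= payoff x t w)%E.
Proof.
case: t => [t| |]//.
  by rewrite !lee_fin; exact: discounted_payoff_ge0.
move=> _; rewrite /= limf_esupE; apply: le_ereal_inf_tmp => _ [V [M [_ MV]] <-].
apply: (@le_trans _ _ (discounted_payoff W beta x (Num.max M 0 + 1) w)%:E).
  by rewrite lee_fin discounted_payoff_ge0// addr_ge0// le_max lexx orbT.
apply: ereal_sup_ubound; exists (Num.max M 0 + 1) => //; apply: MV.
by rewrite (@le_lt_trans _ _ (Num.max M 0)) ?le_max ?lexx// ltrDl.
Qed.

Lemma payoff_bounded_path x w c : (forall s, 0 <= s -> reflected W x s w <= c) ->
  (payoff x +oo w <= 0)%E.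
Proof.
move=> Xc; have c0 : 0 <= c by apply: le_trans (Xc 0 (lexx _)); exact: normr_ge0.
apply/lee_addgt0Pr => e e0; rewrite add0e.
apply: (@limf_esup_pinfty_le _ _ (c / (beta * e))) => s sc.
have be0 : 0 < beta * e by rewrite mulr_gt0.
have s0 : 0 <= s by rewrite (le_trans _ sc)// divr_ge0// ltW.
have d0 : 0 < 1 + beta * s by rewrite ltr_pwDl// mulr_ge0// ltW.
rewrite lee_fin /discounted_payoff ler_pdivrMr//.
rewrite (le_trans (Xc _ s0))//; move: sc; rewrite ler_pdivrMr// => /le_trans; apply.
by rewrite -subr_ge0 (_ : _ - _ = e) ?ltW//; ring.
Qed.

(** The limit superior of [|x + W_s| / (1 + beta s)] only depends on the growth
    rate of the path. *)
Lemma payoff_growth x : 0 <= x ->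
  {ae P, forall w, (payoff x +oo w <= (3 / beta)%:E)%E}.
Proof.
move=> x0; apply: filterS (ae_linear_growth BW) => w [n0 Wn0].
apply: (@limf_esup_pinfty_le _ _ (n0%:R + (x + 2))) => s sn.
have ns : n0%:R <= s by apply: le_trans sn; rewrite lerDl addr_ge0.
have xs : x + 2 <= s by apply: le_trans sn; rewrite lerDr.
have s0 : 0 <= s by rewrite (le_trans _ ns).
have d0 : 0 < 1 + beta * s by rewrite ltr_pwDl// mulr_ge0// ltW.
rewrite lee_fin /discounted_payoff ler_pdivrMr// mulrDr mulr1 mulrA divfK ?gt_eqF//.
have := Wn0 s ns; have := ler_normD x (W s w); rewrite (ger0_norm x0) /reflected.
have : 0 <= 3 / beta by rewrite divr_ge0// ltW.
lra.
Qed.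

Lemma reflected_continuous x w : continuous (fun s : R => reflected W x `|s| w).
Proof. exact: dist_path_continuous. Qed.

Section HittingTime.
Variables (tau : R -> bool) (x : R).
Hypothesis x0 : 0 <= x.
Local Notation hit := (hitting_time W tau x).
Local Notation ker := (policy_ker tau).

Lemma hitting_time_ge0 w : (0 <= hit w)%E.
Proof. by apply: le_ereal_inf_tmp => _ [s [s0 _] <-]; rewrite lee_fin ltW. Qed.

Lemma hitting_timeP w : (exists2 l, 0 <= l & hit w = l%:E) \/ hit w = +oo%E.
Proof.
have := hitting_time_ge0 w; case E : (hit w) => [l| |]//.
- by rewrite lee_fin => l0; left; exists l.
- by right.
Qed.

Lemma payoff_hit_ge0 w : (0 <= payoff x (hit w) w)%E.
Proof. by apply: payoff_ge0; exact: hitting_time_ge0. Qed.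

Lemma hitting_time_closure w l : hit w = l%:E -> closure ker (reflected W x l w).
Proof.
move=> El; have l0 : 0 <= l by rewrite -lee_fin -El hitting_time_ge0.
rewrite -[X in reflected W x X w](ger0_norm l0).
have := @closed_first_time R (closure ker) _ _ l (@closed_closure _ ker)
  (@reflected_continuous x w) _ El; apply.
move=> s [s0 ts]; apply: subset_closure.
by rewrite gtr0_norm//; split; first exact: normr_ge0.
Qed.

(** The intermediate value theorem.  The path [f] is either [X] itself or the
    signed path [x + W]; the time of crossing is positive because the crossed
    point differs from [x]. *)
Lemma crossing_hits (f : R -> R) w t dd : continuous f ->
  (forall s, 0 <= s -> `|f s| = reflected W x s w) -> f 0 = x ->
  0 <= t -> ker dd -> dd != x -> Num.min x (f t) <= dd <= Num.max x (f t) ->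
  (hit w <= t%:E)%E.
Proof.
move=> cf fX f0 t0 [dd0 kd] ddx mid.
have {}mid : Num.min (f 0) (f t) <= dd <= Num.max (f 0) (f t) by rewrite f0.
have [] := IVT t0 (continuous_subspaceT cf) mid => s.
rewrite in_itv/= => /andP[s0 st] fs.
have {}s0 : 0 < s.
  rewrite lt_neqAle s0 andbT; apply/eqP => s00.
  by move: ddx; rewrite -fs -s00 f0 eqxx.
apply: (@le_trans _ _ s%:E); last by rewrite lee_fin.
have E : reflected W x s w = dd by rewrite -(fX s (ltW s0)) fs ger0_norm.
apply: ereal_inf_lbound; exists s => //; split=> //.
by rewrite E.
Qed.

Lemma reflected_crossing_hits w t dd : 0 <= t -> ker dd -> dd != x ->
  Num.min x (reflected W x t w) <= dd <= Num.max x (reflected W x t w) ->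
  (hit w <= t%:E)%E.
Proof.
move=> t0 kd ddx mid.
apply: (crossing_hits (@reflected_continuous x w) _ _ t0 kd ddx).
- by move=> s s0; rewrite /reflected normr_id (ger0_norm s0).
- by rewrite normr0 /reflected (bm_start BW) addr0 ger0_norm.
- by rewrite (ger0_norm t0).
Qed.

End HittingTime.

End Payoff.

(** * Values for a kernel that is dense above a cutoff *)

Section Value.
Context d (T : measurableType d) (R : realType) (P : probability T R).
Variable W : R -> {RV P >-> R}.
Hypothesis BW : brownian_motion W.
Variable beta : R.
Hypothesis beta0 : 0 < beta.
Local Notation payoff := (payoff_at W beta).
Local Notation Phi := (Phi beta).
Local Notation X := (reflected W).
Local Notation ker := policy_ker.
Local Notation hit := (hitting_time W).
Local Notation value tau x := (J W beta x (hit tau x)).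

Local Notation exit_disc y r :=
  (exit_value W y r (fun s _ => 1 / (1 + beta * s))).

Lemma discount_gt0 s : 0 <= s -> 0 < 1 + beta * s.
Proof. by move=> s0; rewrite ltr_pwDl// mulr_ge0// ltW. Qed.

Lemma exit_disc_ge0 y r w : 0 <= exit_disc y r w.
Proof.
rewrite /exit_value; have [[l l0 ->]|->//] := exit_timeP W y r w.
by rewrite divr_ge0// ltW// discount_gt0.
Qed.

Lemma measurable_exit_hyperbolic y r (V : R -> T -> R) :
  measurable_fun setT (exit_value W y r (fun s w => V s w * expR (- (1 * s)))) ->
  measurable_fun setT (exit_value W y r (fun s w => V s w / (1 + beta * s))).
Proof.
move=> mV; pose tau w := fine (exit_time W y r w).
have mtau : measurable_fun setT tau.
  by apply: measurableT_comp; [exact: fine_measurable|exact: measurable_exit_time].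
rewrite (_ : exit_value W y r _ = fun w =>
   exit_value W y r (fun s w => V s w * expR (- (1 * s))) w *
   (expR (tau w) * (1 + beta * `|tau w|)^-1)).
  apply: measurable_funM => //; apply: measurable_funM; first exact: measurableT_comp.
  have cinv : continuous (fun z : R => (1 + beta * `|z|)^-1).
    move=> z; apply: cvgV; first by rewrite gt_eqF// discount_gt0.
    apply: cvgD; first exact: cvg_cst.
    by apply: cvgM; [exact: cvg_cst|apply: cvg_norm; exact: cvg_id].
  exact: (measurableT_comp (continuous_measurable_fun cinv) mtau).
apply/funext => w; rewrite /exit_value /tau.
have [[l l0 ->]|->] := exit_timeP W y r w; last by rewrite mul0r.
rewrite /= ger0_norm// mulrA -[_ * expR l]mulrA -expRD.
by rewrite (_ : _ + l = 0) ?expR0 ?mulr1//; ring.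
Qed.

Lemma measurable_exit_disc y r : measurable_fun setT (exit_disc y r).
Proof.
apply: measurable_exit_hyperbolic.
have := @measurable_exit_discount _ _ _ _ W BW y r 1 ltr01.
congr measurable_fun; apply/funext => w.
by rewrite /exit_value; case: exit_time => // l; rewrite [RHS]mul1r.
Qed.

Lemma value_ub x tau (c : R) (f : T -> R) : 0 <= c ->
  measurable_fun setT f -> (forall w, 0 <= f w) ->
  {ae P, forall w, (payoff x (hit tau x w) w <= (c * f w)%:E)%E} ->
  (value tau x <= c%:E * \int[P]_w (f w)%:E)%E.
Proof.
move=> c0 mf f0 cf; rewrite -ge0_integralZl//.
- apply: ae_ub_integral => //.
  + by move=> w; exact: payoff_hit_ge0.
  + by move=> w; rewrite -EFinM lee_fin mulr_ge0.
  + by apply: measurable_funeM; exact/measurable_EFinP.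
- exact/measurable_EFinP.
- by move=> w _; rewrite lee_fin.
Qed.

Lemma value_lb x tau (c : R) (f : T -> R) : 0 <= c ->
  measurable_fun setT f -> (forall w, 0 <= f w) ->
  (forall w, ((c * f w)%:E <= payoff x (hit tau x w) w)%E) ->
  (c%:E * \int[P]_w (f w)%:E <= value tau x)%E.
Proof.
move=> c0 mf f0 cf; rewrite -ge0_integralZl//.
- apply: le_ge0_integral => // w; first by rewrite -EFinM lee_fin mulr_ge0.
- exact/measurable_EFinP.
- by move=> w _; rewrite lee_fin.
Qed.

Section DenseAbove.
Variables (tau : R -> bool) (a x : R).
Hypothesis a0 : 0 <= a.
Hypothesis kerE : closure (ker tau) = `[a, +oo[%classic.
Hypothesis x0 : 0 <= x.

Lemma ker_ge y : ker tau y -> a <= y.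
Proof. by move=> /subset_closure; rewrite kerE /= in_itv/= andbT. Qed.

Lemma ker_dense u v : a <= u -> u < v -> exists2 y, ker tau y & u < y < v.
Proof.
move=> au uv; have : closure (ker tau) ((u + v) / 2).
  by rewrite kerE /= in_itv/= andbT; lra.
move=> /(_ `]u, v[%classic)[].
  by apply: open_nbhs_nbhs; split; [exact: interval_open|rewrite /= in_itv/=; lra].
by move=> y [ky]; rewrite /= in_itv/= => uyv; exists y.
Qed.

Lemma hit_place_ge l w : hit tau x w = l%:E -> a <= X x l w.
Proof.
move=> /(hitting_time_closure BW)/=; rewrite kerE /= in_itv/= andbT; exact.
Qed.

(** To rise above [a] the path would have to cross the kernel. *)
Lemma before_hit_le_cutoff w t : x <= a -> 0 <= t -> (t%:E < hit tau x w)%E ->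
  X x t w <= a.
Proof.
move=> xa t0; apply: contraTT; rewrite -!leNgt -ltNge => aX.
have [y ky /andP[ay yX]] := ker_dense (lexx a) aX.
apply: (reflected_crossing_hits BW x0 t0 ky).
  by rewrite gt_eqF// (le_lt_trans xa).
by rewrite ge_min le_max (ltW yX) orbT (ltW (le_lt_trans xa ay)).
Qed.

Lemma hit_place_le_cutoff w l : x <= a -> hit tau x w = l%:E -> X x l w <= a.
Proof.
move=> xa El; have l0 : 0 <= l by rewrite -lee_fin -El hitting_time_ge0.
rewrite -[Y in X x Y w](ger0_norm l0).
apply: (le_before_le_at (@reflected_continuous _ _ _ _ W BW x w)) => //.
  by rewrite normr0 /reflected (bm_start BW) addr0 ger0_norm.
move=> s /andP[s0 sl]; apply: before_hit_le_cutoff => //.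
by rewrite El lte_fin gtr0_norm.
Qed.

(** The kernel lies above [a], so it is not met before [T(x, a)]; and at the
    hitting time the path is at [a]. *)
Lemma payoff_le_exit w : x <= a ->
  (payoff x (hit tau x w) w <= (a * exit_disc x a w)%:E)%E.
Proof.
move=> xa; have [[l l0 El]|Ehit] := hitting_timeP W tau x w; last first.
  rewrite Ehit; apply: (@le_trans _ _ 0%E); last by rewrite lee_fin mulr_ge0// exit_disc_ge0.
  apply: (payoff_bounded_path beta0 (c := a)) => s s0.
  by apply: before_hit_le_cutoff => //; rewrite Ehit ltry.
have Xla : X x l w = a.
  by apply/eqP; rewrite eq_le (hit_place_le_cutoff xa El) (hit_place_ge El).
have el : (exit_time W x a w <= l%:E)%E by apply: exit_time_le => //; rewrite -Xla.
rewrite El lee_fin /discounted_payoff Xla /exit_value.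
have [[e e0 Ee]|Ee] := exit_timeP W x a w; last by rewrite Ee in el.
rewrite Ee mul1r ler_wpM2l// lef_pV2 ?posrE ?discount_gt0// lerD2l ler_wpM2l ?(ltW beta0)//.
by rewrite Ee lee_fin in el.
Qed.

(** The kernel has been met when the path reaches [b > a]. *)
Lemma exit_le_payoff b w : x <= a -> a < b ->
  ((a * exit_disc x b w)%:E <= payoff x (hit tau x w) w)%E.
Proof.
move=> xa ab; rewrite /exit_value.
have [[e e0 Ee]|Ee] := exit_timeP W x b w; last first.
  by rewrite Ee mulr0; exact: payoff_hit_ge0.
have [_ bXe] := exit_time_attained BW Ee.
have he : (hit tau x w <= e%:E)%E.
  rewrite leNgt; apply/negP => /(before_hit_le_cutoff xa e0).
  by rewrite leNgt (lt_le_trans ab).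
have [[l l0 El]|El] := hitting_timeP W tau x w; last by rewrite El in he.
rewrite El lee_fin in he; rewrite Ee El lee_fin /discounted_payoff mul1r.
apply: ler_pM => //; first by rewrite invr_ge0 ltW// discount_gt0.
  exact: hit_place_ge.
by rewrite lef_pV2 ?posrE ?discount_gt0// lerD2l ler_wpM2l ?(ltW beta0).
Qed.

Lemma value_below_cutoff_ub : x <= a -> (value tau x <= a%:E * Phi x a)%E.
Proof.
move=> xa; rewrite -(exit_discount BW beta0); last by rewrite ger0_norm.
apply: value_ub => //.
- exact: measurable_exit_disc.
- exact: exit_disc_ge0.
- by apply: aeW => w; exact: payoff_le_exit.
Qed.

Lemma value_below_cutoff_lb : x <= a -> (a%:E * Phi x a <= value tau x)%E.
Proof.
move=> xa; have xa' : `|x| <= a by rewrite ger0_norm.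
have cvgPhi := @Phi_right_continuous _ beta _ _ xa'.
have cvgaPhi : (a%:E * Phi x (a + n.+1%:R^-1))%E @[n --> \oo] --> (a%:E * Phi x a)%E.
  exact: cvgeZl.
apply: (cvge_to_le cvgaPhi); apply: nearW => n.
have n0 : 0 < n.+1%:R^-1 :> R by rewrite invr_gt0.
rewrite -(exit_discount BW beta0); last by rewrite (le_trans xa')// lerDl ltW.
apply: value_lb => //.
- exact: measurable_exit_disc.
- exact: exit_disc_ge0.
- by move=> w; apply: exit_le_payoff => //; rewrite ltrDl.
Qed.

(** The kernel is dense on both sides of [x], so a path that has not hit it has
    not moved. *)
Lemma before_hit_still w t : a < x -> 0 <= t -> (t%:E < hit tau x w)%E -> X x t w = x.
Proof.
move=> ax t0; apply: contraTeq; rewrite -leNgt neq_lt => /orP[Xx|xX].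
  have mx : Num.max a (X x t w) < x by rewrite gt_max ax.
  have [z kz /andP[mz zx]] : exists2 y, ker tau y & Num.max a (X x t w) < y < x.
    by apply: ker_dense => //; rewrite le_max lexx.
  apply: (reflected_crossing_hits BW x0 t0 kz); first by rewrite lt_eqF.
  rewrite ge_min le_max (ltW zx) /= andbT; apply/orP; right.
  by rewrite ltW// (le_lt_trans _ mz)// le_max lexx orbT.
have [z kz /andP[xz zX]] := ker_dense (ltW ax) xX.
apply: (reflected_crossing_hits BW x0 t0 kz); first by rewrite gt_eqF.
by rewrite ge_min le_max (ltW zX) (ltW xz) orbT.
Qed.

Lemma hit_place_still w l : a < x -> hit tau x w = l%:E -> X x l w = x.
Proof.
move=> ax El; have l0 : 0 <= l by rewrite -lee_fin -El hitting_time_ge0.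
apply/eqP; rewrite -subr_eq0 -normr_le0.
rewrite -[Y in X x Y w](ger0_norm l0).
apply: (@le_before_le_at _ (fun s => `|X x `|s| w - x|)) => //.
- move=> s; apply: cvg_norm; apply: cvgB; last exact: cvg_cst.
  exact: reflected_continuous.
- by rewrite /= normr0 /reflected (bm_start BW) addr0 (ger0_norm x0) subrr normr0.
- move=> s /andP[s0 sl]; rewrite (before_hit_still ax) ?subrr ?normr0//.
  by rewrite El lte_fin gtr0_norm.
Qed.

(** The kernel has been met when [W] leaves any interval around 0, and the mean
    discount factor at that time tends to 1 as the interval shrinks. *)
Lemma value_inside : a < x -> value tau x = x%:E.
Proof.
move=> ax; have x0' : 0 < x by exact: le_lt_trans ax.
apply/eqP; rewrite eq_le; apply/andP; split.
  rewrite -[leRHS]mule1 -(probability_setT P) -[P _]mul1e -integral_cst//.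
  apply: value_ub => //; apply: aeW => w; rewrite mulr1.
  have [[l l0 El]|El] := hitting_timeP W tau x w.
    rewrite El lee_fin /discounted_payoff (hit_place_still ax El).
    by rewrite ler_pdivrMr ?discount_gt0// ler_peMr// lerDl mulr_ge0// ltW.
  rewrite El; apply: (@le_trans _ _ 0%E); last by rewrite lee_fin.
  apply: (payoff_bounded_path beta0 (c := x)) => s s0.
  by rewrite (before_hit_still ax)// El ltry.
have n0 : `|0 : R| <= 0 by rewrite normr0.
have cvgxPhi : (x%:E * Phi 0 (0 + n.+1%:R^-1))%E @[n --> \oo] --> (x%:E * Phi 0 0)%E.
  by apply: cvgeZl => //; exact: Phi_right_continuous.
rewrite Phi_diag mule1 in cvgxPhi.
apply: (cvge_to_le cvgxPhi); near=> n.
have e0 : 0 < n.+1%:R^-1 :> R by rewrite invr_gt0.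
have ex : n.+1%:R^-1 < x by near: n; exact: near_infty_natSinv_lt (PosNum x0').
rewrite add0r -(exit_discount BW beta0); last by rewrite normr0 ltW.
apply: value_lb => //.
- exact: measurable_exit_disc.
- exact: exit_disc_ge0.
move=> w; rewrite /exit_value; set r := n.+1%:R^-1 in e0 ex *.
have [[e e1 Ee]|Ee] := exit_timeP W 0 r w; last first.
  by rewrite Ee mulr0; exact: payoff_hit_ge0.
have yr : `|0 : R| <= r by rewrite normr0 ltW.
have We := exit_time_eq BW yr Ee; rewrite add0r in We.
have he : (hit tau x w <= e%:E)%E.
  rewrite leNgt; apply/negP => /(before_hit_still ax e1).
  move: We => /eqP; rewrite eqr_norml /reflected => /andP[/orP[]/eqP -> _].
    by rewrite gtr0_norm ?addr_gt0//; lra.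
  by rewrite gtr0_norm ?subr_gt0//; lra.
have [[l l0 El]|El] := hitting_timeP W tau x w; last by rewrite El in he.
rewrite El lee_fin in he; rewrite Ee El lee_fin /discounted_payoff mul1r.
rewrite (hit_place_still ax El) ler_wpM2l//.
by rewrite lef_pV2 ?posrE ?discount_gt0// lerD2l ler_wpM2l ?(ltW beta0).
Unshelve. all: end_near. Qed.

End DenseAbove.
End Value.

(** * Bounded kernels and gaps *)

Section Gaps.
Context d (T : measurableType d) (R : realType) (P : probability T R).
Variable W : R -> {RV P >-> R}.
Hypothesis BW : brownian_motion W.
Variable beta : R.
Hypothesis beta0 : 0 < beta.
Local Notation payoff := (payoff_at W beta).
Local Notation Phi := (Phi beta).
Local Notation X := (reflected W).
Local Notation ker := policy_ker.
Local Notation hit := (hitting_time W).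
Local Notation value tau x := (J W beta x (hit tau x)).
Local Notation exit_disc y r :=
  (exit_value W y r (fun s _ => 1 / (1 + beta * s))).

(** The payoff is at most the largest state in the kernel, or the growth rate
    of the path if it never hits; both are bounds independent of [x]. *)
Lemma value_above_bounded_ker tau (M : R) : 0 <= M ->
  (forall y, ker tau y -> y <= M) ->
  exists x, M < x /\ (value tau x < x%:E)%E.
Proof.
move=> M0 kM; exists (M + 3 / beta + 1).
have b0 : 0 < 3 / beta by rewrite divr_gt0.
set x := _ + 1; have x0 : 0 <= x by rewrite !addr_ge0// ltW.
split; first by rewrite /x; lra.
apply: (@le_lt_trans _ _ (M + 3 / beta)%:E); last by rewrite lte_fin /x; lra.
have c0 : 0 <= M + 3 / beta by rewrite addr_ge0// ltW.
rewrite -[leRHS]mule1 -(probability_setT P) -[P _]mul1e -integral_cst//.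
apply: (value_ub beta0) => //.
apply: filterS (payoff_growth BW beta0 x0) => w growth; rewrite mulr1.
have [[l l0 El]|El] := hitting_timeP W tau x w; rewrite El; last first.
  by apply: (le_trans growth); rewrite lee_fin lerDr.
have XM : X x l w <= M.
  have kX := hitting_time_closure BW El.
  have : closed [set y : R | y <= M] by exact: closed_le.
  by apply; apply: closure_subset kX => y /kM.
rewrite lee_fin /discounted_payoff ler_pdivrMr ?discount_gt0//.
rewrite (le_trans XM)//; have : 0 <= (M + 3 / beta) * (beta * l).
  by rewrite mulr_ge0// mulr_ge0// ltW.
by rewrite mulrDr mulr1; have := ltW b0; lra.
Qed.

(** Exiting a level means, almost surely, exiting slightly larger levels just
    after: the discount factors decrease with the level, and their means
    converge by continuity of [Phi]. *)
Lemma ae_exit_right_continuous r : 0 < r ->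
  {ae P, forall w, forall dl, 0 < dl ->
    exists n : nat, exit_disc 0 r w - exit_disc 0 (r + n.+1%:R^-1) w < dl}.
Proof.
move=> r0; have yr : `|0 : R| <= r by rewrite normr0 ltW.
have n0 n : 0 < n.+1%:R^-1 :> R by rewrite invr_gt0.
pose g n w := exit_disc 0 r w - exit_disc 0 (r + n.+1%:R^-1) w.
have mD q : measurable_fun setT (exit_disc 0 q) by exact: measurable_exit_disc.
have mg n : measurable_fun setT (g n) by exact: measurable_funB.
have g0 n w : 0 <= g n w.
  rewrite subr_ge0 {1}/exit_value.
  have [[e e0 Ee]|Ee] := exit_timeP W 0 (r + n.+1%:R^-1) w; rewrite Ee; last first.
    exact: exit_disc_ge0.
  have [_ re] := exit_time_attained BW Ee.
  have le : (exit_time W 0 r w <= e%:E)%E.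
    by apply: exit_time_le => //; rewrite (le_trans _ re)// lerDl ltW.
  rewrite /exit_value; have [[l l0 El]|El] := exit_timeP W 0 r w; last by rewrite El in le.
  rewrite El lee_fin in le; rewrite El !mul1r.
  by rewrite lef_pV2 ?posrE ?discount_gt0// lerD2l ler_wpM2l ?(ltW beta0).
have Eg n : (\int[P]_w (g n w)%:E = Phi 0 r - Phi 0 (r + n.+1%:R^-1))%E.
  have yrn : `|0 : R| <= r + n.+1%:R^-1 by rewrite normr0 addr_ge0// ltW.
  have sumE : (Phi 0 r = \int[P]_w (g n w)%:E + Phi 0 (r + n.+1%:R^-1))%E.
    rewrite -!(exit_discount BW beta0)// -ge0_integralD//.
    - by apply: eq_integral => w _; rewrite -EFinD subrK.
    - by move=> w _; rewrite lee_fin g0.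
    - exact/measurable_EFinP.
    - by move=> w _; rewrite lee_fin; exact: exit_disc_ge0.
    - exact/measurable_EFinP.
  by rewrite sumE addeK// Phi_fin_num.
(* The exceptional paths, where the difference stays above [1 / (k + 1)]. *)
pose E k := \bigcap_n [set w | k.+1%:R^-1 <= g n w].
have mge k n : measurable [set w | k.+1%:R^-1 <= g n w].
  rewrite -[S in measurable S]setTI.
  have := mg n measurableT `[k.+1%:R^-1, +oo[%classic (measurable_itv _).
  by congr (_ _ (_ `&` _)); apply/seteqP; split => w /=; rewrite in_itv/= andbT.
have mE k : measurable (E k) by apply: bigcap_measurable => // n _; exact: mge.
have E0 k : P (E k) = 0.
  have k0 : 0 < k.+1%:R^-1 :> R by rewrite invr_gt0.
  have Ekle n : ((k.+1%:R^-1 : R)%:E * P (E k) <= Phi 0 r - Phi 0 (r + n.+1%:R^-1))%E.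
    rewrite -Eg; apply: (ge0_markov P (ltW k0) (mE k) (mg n) (g0 n)) => w Ew.
    exact: Ew.
  have cv : (Phi 0 r - Phi 0 (r + n.+1%:R^-1))%E @[n --> \oo] --> (Phi 0 r - Phi 0 r)%E.
    apply: cvgeB; first by rewrite fin_num_adde_defr// Phi_fin_num.
      exact: cvg_cst.
    exact: Phi_right_continuous.
  rewrite subee ?Phi_fin_num// in cv.
  have : ((k.+1%:R^-1 : R)%:E * P (E k) <= 0)%E.
    by apply: (cvge_to_ge cv); apply: nearW.
  by rewrite pmule_rle0// measure_le0 => /eqP.
have mU : measurable (\bigcup_k E k) by exact: bigcup_measurable.
have U0 : P (\bigcup_k E k) = 0.
  apply/eqP; rewrite -measure_le0 (le_trans (le_mu_bigcup P mE mU))//.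
  by rewrite eseries0 ?lexx// => k *; exact: E0.
exists (\bigcup_k E k); split => // w nw; apply: contrapT => nU; apply: nw => dl dl0.
apply: contrapT => ng; apply: nU.
exists (Num.truncn dl^-1) => // n _ /=.
have : dl <= g n w.
  by rewrite leNgt; apply/negP => gd; apply: ng; exists n.
apply: le_trans; rewrite invf_ple ?posrE ?ltr0n//.
by rewrite ltW ?truncnS_gt.
Qed.

Section Gap.
Variables (tau : R -> bool) (b c : R).
Hypothesis b0 : 0 <= b.
Hypothesis bc : b < c.
Hypothesis kb : closure (ker tau) b.
Hypothesis kc : closure (ker tau) c.
Hypothesis gap : forall y, b < y < c -> ~ ker tau y.

Let m := (b + c) / 2.
Let r := (c - b) / 2.

Let m0 : 0 < m. Proof. by rewrite /m; have := b0; have := bc; lra. Qed.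
Let r0 : 0 < r. Proof. by rewrite /r; have := bc; lra. Qed.
Let rm : r <= m. Proof. by rewrite /r /m; have := b0; lra. Qed.

(** Within the gap there is nothing to hit. *)
Lemma gap_exit_le_hit w : (exit_time W 0 r w <= hit tau m w)%E.
Proof.
apply: le_ereal_inf_tmp => _ [s [s0 ks] <-]; apply: exit_time_le; first exact: ltW.
rewrite add0r leNgt; apply/negP; rewrite ltr_norml => /andP[rW Wr].
have bX : b < m + W s w by move: rW; rewrite /r /m; lra.
have Xc : m + W s w < c by move: Wr; rewrite /r /m; lra.
have XE : X m s w = m + W s w by rewrite /reflected ger0_norm// (le_trans b0)// ltW.
apply: (gap (y := m + W s w)); first by rewrite bX Xc.
by split; [rewrite (le_trans b0)// ltW|rewrite -XE].
Qed.

(** The ends of the gap are limits of the kernel from outside, so a path that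
    leaves a strictly larger interval has crossed the kernel.  The signed path
    is used as the interval may extend below 0. *)
Lemma hit_le_larger_exit w n e : exit_time W 0 (r + n.+1%:R^-1) w = e%:E ->
  (hit tau m w <= e%:E)%E.
Proof.
move=> Ee; set u : R := n.+1%:R^-1; have u0 : 0 < u by rewrite invr_gt0.
have [e0 _] := exit_time_attained BW Ee.
have yr : `|0 : R| <= r + u by rewrite normr0 addr_ge0// ltW.
have := exit_time_eq BW yr Ee; rewrite add0r => /eqP.
have cf : continuous (fun s : R => m + W `|s| w).
  by move=> s; apply: cvgD; [exact: cvg_cst|exact: path_continuous].
have near_ker z : closure (ker tau) z -> exists2 y, ker tau y & z - Num.min u r < y < z + Num.min u r.
  move=> /(_ `]z - Num.min u r, z + Num.min u r[%classic)[].
    apply: open_nbhs_nbhs; split; first exact: interval_open.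
    have : 0 < Num.min u r by rewrite lt_min u0 r0.
    by move=> h; rewrite /= in_itv/= ltrBlDr !ltrDl h.
  by move=> y [ky]; rewrite /= in_itv/= => ?; exists y.
have minu : Num.min u r <= u by rewrite ge_min lexx.
have minr : Num.min u r <= r by rewrite ge_min lexx orbT.
rewrite eqr_norml => /andP[/orP[]/eqP We _].
  have [y ky /andP[y1 y2]] := near_ker _ kc.
  have cy : c <= y.
    rewrite leNgt; apply/negP => yc; apply: (gap (y := y)) => //.
    by rewrite yc andbT; move: y1 minr; rewrite /r; have := bc; lra.
  apply: (crossing_hits (f := fun s => m + W `|s| w) cf _ _ e0 ky).
  - by move=> s s0; rewrite (ger0_norm s0).
  - by rewrite normr0 (bm_start BW) addr0.
  - by rewrite gt_eqF// (lt_le_trans _ cy)// /m; have := bc; lra.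
  rewrite (ger0_norm e0) We ge_min le_max; apply/andP; split; apply/orP.
    by left; rewrite (le_trans _ cy)// /m; have := bc; lra.
  by right; move: y2 minu; rewrite /m /r; lra.
have [y ky /andP[y1 y2]] := near_ker _ kb.
have yb : y <= b.
  rewrite leNgt; apply/negP => by_; apply: (gap (y := y)) => //.
  by rewrite by_ /=; move: y2 minr; rewrite /r; have := bc; lra.
apply: (crossing_hits (f := fun s => m + W `|s| w) cf _ _ e0 ky).
- by move=> s s0; rewrite (ger0_norm s0).
- by rewrite normr0 (bm_start BW) addr0.
- by rewrite lt_eqF// (le_lt_trans yb)// /m; have := bc; lra.
rewrite (ger0_norm e0) We ge_min le_max; apply/andP; split; apply/orP.
  by right; move: y1 minu; rewrite /m /r; lra.
by left; rewrite (le_trans yb)// /m; have := bc; lra.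
Qed.

(** In the middle [m] of the gap the hitting time is, almost surely, the time
    of exit from the gap.  The exit place has mean [m] and does not correlate
    with the discount factor, so waiting is worth [m * Phi 0 r]. *)
Lemma value_gap_lt : exists x, [/\ 0 <= x, b < x < c & (value tau x < x%:E)%E].
Proof.
exists m; split; [exact: ltW|by rewrite /m; have := bc; lra|].
have yr : `|0 : R| <= r by rewrite normr0 ltW.
apply: (@le_lt_trans _ _ (m%:E * Phi 0 r)%E); last first.
  have := Phi0_lt1 beta0 r0; rewrite -(fineK (Phi_fin_num beta yr)).
  by rewrite -EFinM !lte_fin => h; rewrite gtr_pMr.
rewrite -(exit_place_discount BW beta0)//.
apply: ae_ub_integral.
- by move=> w; apply: payoff_hit_ge0.
- move=> w; rewrite lee_fin /exit_value.
  have [[l l0 El]|->//] := exit_timeP W 0 r w; rewrite El.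
  rewrite divr_ge0 ?(ltW (discount_gt0 beta0 l0))//.
  have := exit_time_eq BW yr El; rewrite add0r => /eqP.
  by rewrite eqr_norml => /andP[/orP[]/eqP -> _]; have := rm; have := r0; lra.
- apply/measurable_EFinP/(measurable_exit_hyperbolic BW beta0).
  exact: measurable_exit_place.
apply: filterS (ae_exit_right_continuous r0) => w close.
rewrite /exit_value; have lehit := gap_exit_le_hit w.
have [[l l0 El]|El] := exit_timeP W 0 r w; last first.
  rewrite El leye_eq in lehit; rewrite El (eqP lehit).
  apply: (payoff_bounded_path beta0 (c := m + r)) => s s0.
  rewrite /reflected (le_trans (ler_normD _ _))// (gtr0_norm m0) lerD2l ltW//.
  by have := no_exit_bounded El s0; rewrite add0r.
have hitE : hit tau m w = l%:E.
  apply/eqP; rewrite eq_le -{2}El lehit andbT leNgt; apply/negP => lhit.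
  (* A late hit would leave a gap between the discount factor at the exit and
     all those at the exits from larger intervals. *)
  pose k := if hit tau m w is h%:E then 1 / (1 + beta * h) else 0.
  have kl : k < exit_disc 0 r w.
    rewrite /k /exit_value El; have [[h h0 Eh]|->] := hitting_timeP W tau m w.
      rewrite Eh lte_fin in lhit; rewrite Eh !mul1r.
      by rewrite ltf_pV2 ?posrE ?discount_gt0// ltrD2l ltr_pM2l.
    by rewrite divr_gt0// discount_gt0.
  have := close (exit_disc 0 r w - k); rewrite subr_gt0 => /(_ kl)[n].
  rewrite ltrD2l ltrN2 ltNge => /negP; apply.
  rewrite {1}/exit_value; have [[e e0 Ee]|Ee] := exit_timeP W 0 (r + n.+1%:R^-1) w.
    have he := hit_le_larger_exit Ee.
    rewrite Ee /k; have [[h h0 Eh]|Eh] := hitting_timeP W tau m w; last by rewrite Eh in he.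
    rewrite Eh lee_fin in he; rewrite Eh !mul1r.
    by rewrite lef_pV2 ?posrE ?discount_gt0// lerD2l ler_wpM2l ?(ltW beta0).
  rewrite Ee /k; have [[h h0 ->]|->//] := hitting_timeP W tau m w.
  by rewrite divr_ge0// ltW// discount_gt0.
rewrite hitE El lee_fin /discounted_payoff /reflected ger0_norm//.
have := exit_time_eq BW yr El; rewrite add0r => /eqP.
by rewrite eqr_norml => /andP[/orP[]/eqP -> _]; have := rm; have := r0; lra.
Qed.

End Gap.
End Gaps.

(** * Equilibria *)

Lemma closure_inf (R : realType) (A : set R) : has_inf A -> closure A (inf A).
Proof.
move=> hA B [e /= e0 eB]; have [y Ay ye] := inf_adherent e0 hA.
exists y; split=> //; apply: eB; rewrite /ball/= distrC ger0_norm ?ltrBlDl//.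
by rewrite subr_ge0 ge_inf//; case: hA.
Qed.

Section Equilibria.
Context d (T : measurableType d) (R : realType) (P : probability T R).
Variable W : R -> {RV P >-> R}.
Hypothesis BW : brownian_motion W.
Variables beta astar : R.
Hypothesis beta0 : 0 < beta.
Hypothesis astar0 : 0 < astar.
Hypothesis astarE : (astar%:E * \int[lebesgue_measure]_(s in `[0%R, +oo[)
     (expR (- s) * Num.sqrt (2 * beta * s)
        * tanh (astar * Num.sqrt (2 * beta * s)))%:E = 1)%E.
Local Notation ker := policy_ker.
Local Notation value tau x := (J W beta x (hitting_time W tau x)).

Section Necessary.
Variable tau : R -> bool.
Hypothesis eqtau : forall x, 0 <= x -> Theta W beta tau x = tau x.

Lemma value_lt_ker x : 0 <= x -> (value tau x < x%:E)%E -> ker tau x.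
Proof. by move=> x0 vx; split=> //; rewrite -eqtau// /Theta vx. Qed.

Lemma ker_unbounded (M : R) : 0 <= M -> exists2 y, ker tau y & M < y.
Proof.
move=> M0; apply: contrapT => nM.
have kM y : ker tau y -> y <= M.
  by move=> ky; rewrite leNgt; apply/negP => My; apply: nM; exists y.
have [x [Mx vx]] := value_above_bounded_ker BW beta0 M0 kM.
have := kM x (value_lt_ker (le_trans M0 (ltW Mx)) vx).
by rewrite leNgt Mx.
Qed.

Let a := inf (ker tau).

Let ker_has_inf : has_inf (ker tau).
Proof.
split; first by have [y ky _] := ker_unbounded (lexx 0); exists y.
by exists 0 => y [].
Qed.

Let a0 : 0 <= a.
Proof. by apply: lb_le_inf => [|y []//]; case: ker_has_inf. Qed.

Lemma ker_closure_ge y : closure (ker tau) y -> a <= y.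
Proof.
have : closed [set y : R | a <= y] by exact: closed_ge.
move=> cl; move=> ky; apply: cl; apply: closure_subset ky => z kz.
by apply: ge_inf => //; case: ker_has_inf.
Qed.

(** A point outside the closure of the kernel lies in a gap of it, bounded on
    the right because the kernel is unbounded. *)
Lemma ker_closure_above z : a <= z -> closure (ker tau) z.
Proof.
move=> az; apply: contrapT => nz; set C := closure (ker tau) in nz.
have cC : closed C by exact: closed_closure.
have Ca : C a by exact: closure_inf.
(* The gap around [z] runs from the supremum of [lo] to the infimum of [hi]. *)
pose lo := [set y | C y /\ y <= z]; pose hi := [set y | C y /\ z <= y].
have lo_sup : has_sup lo by split; [exists a|exists z => y []].
have hi_inf : has_inf hi.
  split; last by exists z => y [].
  have z0 : 0 <= z by exact: le_trans az.
  by have [y ky zy] := ker_unbounded z0; exists y; split; [exact: subset_closure|exact: ltW].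
pose b := sup lo; pose c := inf hi.
have Cb : C b.
  apply: cC; have : closure lo b by apply: closure_sup; case: lo_sup.
  by apply: closure_subset => y [].
have Cc : C c.
  apply: cC; have : closure hi c by exact: closure_inf.
  by apply: closure_subset => y [].
have bz : b <= z by apply: ge_sup => [|y []//]; case: lo_sup.
have zc : z <= c by apply: lb_le_inf => [|y []//]; case: hi_inf.
have {}bz : b < z.
  by rewrite lt_neqAle bz andbT; apply/eqP => bzE; apply: nz; rewrite -bzE.
have {}zc : z < c.
  by rewrite lt_neqAle zc andbT; apply/eqP => zcE; apply: nz; rewrite zcE.
have b0 : 0 <= b by rewrite (le_trans a0)// ker_closure_ge.
have gap y : b < y < c -> ~ ker tau y.
  move=> /andP[by_ yc] ky; have Cy : C y by exact: subset_closure.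
  have [yz|zy] := leP y z.
    by move: by_; rewrite ltNge ub_le_sup//; case: lo_sup.
  by move: yc; rewrite ltNge ge_inf//; [case: hi_inf|split=> //; exact: ltW].
have [x [x0 bxc vx]] := value_gap_lt BW beta0 b0 (lt_trans bz zc) Cb Cc gap.
exact: gap bxc (value_lt_ker x0 vx).
Qed.

Lemma equilibrium_closure :
  exists2 a, 0 <= a <= astar & closure (ker tau) = `[a, +oo[%classic.
Proof.
have kerE : closure (ker tau) = `[a, +oo[%classic.
  apply/seteqP; split => y /=; rewrite in_itv/= andbT.
    exact: ker_closure_ge.
  exact: ker_closure_above.
exists a => //; rewrite a0 /= leNgt; apply/negP => aastar.
have [x [x0 xa wx]] := waiting_lt_place beta0 astar0 astarE aastar.
have vx : (value tau x < x%:E)%E.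
  apply: le_lt_trans wx.
  exact: (value_below_cutoff_ub BW beta0 a0 kerE x0 (ltW xa)).
have : a <= x by apply: (ker_ge kerE); exact: value_lt_ker.
by rewrite leNgt xa.
Qed.

End Necessary.

Lemma closure_equilibrium tau a : stopping_policy tau -> 0 <= a <= astar ->
  closure (ker tau) = `[a, +oo[%classic -> equilibria W beta tau.
Proof.
move=> mtau /andP[a0 aastar] kerE; split=> // x x0; rewrite /Theta.
have [ax|xa] := ltP a x.
  by rewrite (value_inside BW beta0 a0 kerE x0 ax) ltxx.
have lb := value_below_cutoff_lb BW beta0 a0 kerE x0 xa.
have ub := value_below_cutoff_ub BW beta0 a0 kerE x0 xa.
have wait : (x%:E <= value tau x)%E.
  exact: (le_trans (place_le_waiting astar0 astarE x0 xa aastar) lb).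
rewrite ltNge wait /=; case: ifPn => // vx.
have {}xa : x < a.
  rewrite lt_neqAle xa andbT; apply/eqP => xaE; move: vx; rewrite xaE in ub *.
  by rewrite Phi_diag mule1 in ub; rewrite ltNge ub.
apply/esym; apply: contraT => ntau.
have : a <= x by apply: (ker_ge kerE); split=> //; exact/negbTE.
by rewrite leNgt xa.
Qed.

End Equilibria.

Lemma policy_ker_cutoff (R : realType) (a : R) : 0 <= a -> policy_ker (cutoff a) = `[a, +oo[%classic.
Proof.
move=> a0; apply/seteqP; split => x /=; rewrite in_itv/= andbT /cutoff.
  by move=> [x0]; rewrite x0 /= => /negbT; rewrite -leNgt.
by move=> ax; split; [exact: le_trans ax|apply/negbTE; rewrite negb_and -!leNgt ax orbT].
Qed.

Lemma stopping_policy_cutoff (R : realType) (a : R) : stopping_policy (cutoff a).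
Proof.
apply: measurable_funTS; apply: (measurable_fun_bool true).
rewrite setTI (_ : _ @^-1` _ = `[0, a[%classic)//.
Qed.

Theorem proposition4p2 (R : realType) (d : measure_display)
    (T : measurableType d) (P : probability T R) (W : R -> {RV P >-> R})
    (beta astar : R) :
  measure_is_complete P ->
  brownian_motion W ->
  0 < beta ->
  0 < astar ->
  (astar%:E * \int[lebesgue_measure]_(s in `[0%R, +oo[)
     (expR (- s) * Num.sqrt (2 * beta * s)
        * tanh (astar * Num.sqrt (2 * beta * s)))%:E = 1)%E ->
  (forall a : R, 0 <= a -> (equilibria W beta (cutoff a) <-> a <= astar)) /\
  equilibria W beta =
    [set tau : R -> bool | stopping_policy tau /\
       exists2 a : R, 0 <= a <= astar & closure (policy_ker tau) = `[a, +oo[%classic].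
Proof.
move=> _ BW beta0 astar0 astarE.
have eqE : equilibria W beta =
    [set tau : R -> bool | stopping_policy tau /\
       exists2 a : R, 0 <= a <= astar & closure (policy_ker tau) = `[a, +oo[%classic].
  apply/seteqP; split => tau.
    by move=> [mtau eqtau]; split=> //; exact: (equilibrium_closure BW beta0 astar0 astarE).
  by move=> [mtau [a aastar kerE]]; exact: (closure_equilibrium BW beta0 astar0 astarE mtau aastar kerE).
split=> // a a0; rewrite eqE.
have kerE : closure (policy_ker (cutoff a)) = `[a, +oo[%classic.
  by rewrite policy_ker_cutoff// -(closure_id _).1//; exact: interval_closed.
split=> [[_ [a' /andP[_ a'astar]]]|aastar].
  rewrite kerE => aa'; suff -> : a = a' by [].
  have : `[a', +oo[%classic a' by rewrite /= in_itv/= lexx.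
  rewrite -aa' /= in_itv/= andbT => le1.
  have : `[a, +oo[%classic a by rewrite /= in_itv/= lexx.
  rewrite aa' /= in_itv/= andbT => le2.
  by apply/eqP; rewrite eq_le le1 le2.
by split; [exact: stopping_policy_cutoff|exists a; rewrite ?a0].
Qed.
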